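(* Let $\Sigma$ be distributed according to the uniform biased sparse PCA (UBSPCA) model with parameters $n,p,k,\beta$. Assume that $p/n\to c\ge0$ and that $k\le\frac{n\cdot\min\{\beta^2,\beta\}}{C\log n}$ for a sufficiently large universal constant $C$. If $$k^*\ge\Bigl\lfloor\frac{Ck^2\log n}{\beta^2n}\Bigr\rfloor,$$ then with probability tending to $1$ as $(n,p,k)\to\infty$, SSPCA$(f_{avg},f_{\lambda_1},k,k^* )$ recovers at least a $(1-O(\sqrt{\alpha})-1/k)$-fraction of $\mathcal{I}^*$, where $\alpha=(1+\beta)k/k_{info}$; that is, its output $\mathcal{I}$ satisfies $|\mathcal{I}\cap\mathcal{I}^*|\ge(1-O(\sqrt{\alpha})-1/k)\,k$.
   Context: UBSPCA model: $\mathbf{v}^*\in\mathbb{R}^p$ is a unit vector with exactly $k$ non-zero entries, all equal to $1/\sqrt{k}$, and $\mathcal{I}^*\subseteq\{1,\ldots,p\}$ is its support, $|\mathcal{I}^*|=k$. The signal strength is $\beta\ge0$. The samples $\mathbf{x}_1,\ldots,\mathbf{x}_n\in\mathbb{R}^p$ are i.i.d. from $\mathcal{N}(0,\beta\mathbf{v}^*{\mathbf{v}^*}^T+I_p)$, $X$ is the $n\times p$ matrix whose rows are the samples, and $\Sigma=\frac1n X^TX$. Probability is over the choice of $X$. The quantity $k_{info}$ satisfies $k_{info}\asymp\beta^2n/\log p$, where $f\asymp g$ means that $f/g\to c'$ for some constant $c'>0$. For $\mathcal{S}\subseteq\{1,\ldots,p\}$, $\Sigma_{\mathcal{S}}$ is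 the principal submatrix of $\Sigma$ indexed by $\mathcal{S}$; $f_{avg}(\mathcal{S})=\frac{1}{|\mathcal{S}|}\sum_{i,j\in\mathcal{S}}\Sigma_{i,j}$; and $f_{\lambda_1}(\mathcal{S})=\lambda_1(\Sigma_{\mathcal{S}})$ is the largest eigenvalue of $\Sigma_{\mathcal{S}}$. GreedySPCA$(f,\mathcal{S}^*,k)$: the input is a function $f:2^{\{1,\ldots,p\}}\to\mathbb{R}$, a seed $\mathcal{S}^*\subseteq\{1,\ldots,p\}$ (possibly empty) of size $k^*\le k$, and the solution size $k$. For each $i\in\{1,\ldots,p\}\setminus\mathcal{S}^*$ compute $a_i=f(\mathcal{S}^*\cup\{i\})$; sort these as $a_{i_1}\ge a_{i_2}\ge\dots\ge a_{i_{p-k^*}}$; output $\mathcal{S}^*\cup\{i_1,\ldots,i_{k-k^*}\}$. SSPCA$(f_1,f_2,k,k^* )$ (with integer seed size $0\le k^*\le k$): for every seed $\mathcal{S}^*\subseteq\{1,\ldots,p\}$ of size $k^*$, let $\mathcal{S}^{(\mathcal{S}^* )}$ be the output of GreedySPCA$(f_1,\mathcal{S}^*,k)$. Output a set $\mathcal{S}^{(\mathcal{S}^* )}$ whose value $f_2(\mathcal{S}^{(\mathcal{S}^* )})$ is maximal over all seeds $\mathcal{S}^*$ of size $k^*$. *)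

(* Defs.v *)
From HB Require Import structures.
From mathcomp Require Import all_boot all_order all_algebra.
From mathcomp Require Import all_classical all_reals all_analysis.

Set Implicit Arguments.
Unset Strict Implicit.
Unset Printing Implicit Defensive.
Import Order.TTheory GRing.Theory Num.Theory.
Import numFieldNormedType.Exports.

Local Open Scope classical_set_scope.
Local Open Scope ring_scope.

Section Probability.
Context {d : measure_display} {T : measurableType d} {R : realType}.
Variable P : probability T R.

(* Parametrised by the variance. The degenerate case is separate because
   [normal_prob m 0] is a junk value (the uniform law on [0, 1]). *)
Definition normal_law (m var : R) : set R -> \bar R :=
  if var == 0 then \d_m else normal_prob m (Num.sqrt var).

(* Y ~ N(0, G): every linear form <u, Y> is N(0, u G u^T). *)
Definition centered_gaussian_vector (p : nat) (G : 'M[R]_p)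
    (Y : T -> p.-tuple R) : Prop :=
  forall (u : 'rV[R]_p) (B : set R), measurable B ->
    P [set w | B (\sum_(j < p) u 0 j * tnth (Y w) j)] =
    normal_law 0 ((u *m G *m u^T) 0 0) B.

(* The product rule for subfamilies is the case [A i = setT] outside of the
   subfamily. *)
Definition mutually_independent d' (T' : measurableType d') (n : nat)
    (Y : 'I_n -> T -> T') : Prop :=
  forall A : 'I_n -> set T', (forall i, measurable (A i)) ->
    P [set w | forall i, A i (Y i w)] = (\prod_(i < n) P (Y i @^-1` A i))%E.

End Probability.

(* "E t holds with probability tending to 1", where the event [E t] lives on
   its own probability space. A probability is only meaningful on measurable
   sets, whence the measurable [A t]; if [E t] is measurable this says exactly
   that [P t (E t)] tends to 1. *)
Definition with_probability_tending_to_1 (R : realType)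
    (d : nat -> measure_display) (T : forall t, measurableType (d t))
    (P : forall t, probability (T t) R) (E : forall t, set (T t)) : Prop :=
  exists A : forall t, set (T t),
    (forall t, measurable (A t) /\ A t `<=` E t) /\
    (fun t => P t (A t)) @ \oo --> (1%:E : \bar R).

Section Model.
Context {R : realType}.

Definition support_of (p : nat) (v : 'cV[R]_p) : {set 'I_p} :=
  [set j | v j 0 != 0]%SET.

Definition uniform_biased_spike (p k : nat) (v : 'cV[R]_p) : Prop :=
  [/\ \sum_(j < p) v j 0 ^+ 2 = 1,
      #|support_of v| = k &
      forall j, j \in support_of v -> v j 0 = (Num.sqrt k%:R)^-1].

Definition UBSPCA (d : measure_display) (T : measurableType d)
    (P : probability T R) (n p k : nat) (beta : R) (v : 'cV[R]_p)
    (x : 'I_n -> {mfun T >-> p.-tuple R}) : Prop :=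
  [/\ 0 <= beta,
      uniform_biased_spike k v,
      mutually_independent P (fun i => x i : T -> p.-tuple R) &
      forall i, centered_gaussian_vector P (beta *: (v *m v^T) + 1%:M) (x i)].

Definition data_matrix (T : Type) (n p : nat) (x : 'I_n -> T -> p.-tuple R)
    (w : T) : 'M[R]_(n, p) := \matrix_(i, j) tnth (x i w) j.

Definition sample_covariance (n p : nat) (X : 'M[R]_(n, p)) : 'M[R]_p :=
  n%:R^-1 *: (X^T *m X).

Definition principal_submatrix (p : nat) (A : 'M[R]_p) (S : {set 'I_p}) :
    'M[R]_#|S| := mxsub enum_val enum_val A.

(* Only applied to symmetric matrices, whose set of eigenvalues is finite, and
   nonempty in positive dimension, so that the supremum is a maximum. *)
Definition lambda1 (m : nat) (A : 'M[R]_m) : R := sup [set a | eigenvalue A a].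

Definition f_avg (p : nat) (Sigma : 'M[R]_p) (S : {set 'I_p}) : R :=
  #|S|%:R^-1 * \sum_(i in S) \sum_(j in S) Sigma i j.

Definition f_lambda1 (p : nat) (Sigma : 'M[R]_p) (S : {set 'I_p}) : R :=
  lambda1 (principal_submatrix Sigma S).

(* A relation, since ties in the sort (and in the final maximisation below)
   may be broken arbitrarily: [S] is a possible output. *)
Definition GreedySPCA (p : nat) (f : {set 'I_p} -> R) (seed : {set 'I_p})
    (k : nat) (S : {set 'I_p}) : Prop :=
  exists s : seq 'I_p,
    [/\ perm_eq s (enum (~: seed)%SET),
        sorted (fun i j => f (j |: seed)%SET <= f (i |: seed)%SET) s &
        S = (seed :|: [set i in take (k - #|seed|) s])%SET].

Definition SSPCA (p : nat) (f1 f2 : {set 'I_p} -> R) (k kstar : nat)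
    (S : {set 'I_p}) : Prop :=
  exists out : {set 'I_p} -> {set 'I_p},
    (forall seed : {set 'I_p}, #|seed| = kstar ->
       GreedySPCA f1 seed k (out seed)) /\
    exists2 best : {set 'I_p}, #|best| = kstar &
      S = out best /\
      forall seed : {set 'I_p}, #|seed| = kstar ->
        f2 (out seed) <= f2 (out best).

End Model.

(* Main.v *)
(**
Write q(u) = u G u^T for the population covariance G = beta v v^T + I and Q(u)
for its empirical version. For a fixed u, n Q(u) / q(u) is a chi-square variable
with n degrees of freedom, so Q(u) / q(u) is exponentially concentrated around 1.

Greedy step. For a seed S inside the support, i in the support and j outside of
it, f_avg(S + i) - f_avg(S + j) is proportional to the bilinear form of Q at
e_i - e_j and 2 1_S + e_i + e_j. Polarising with normalised vectors, it differs
from its mean beta (2 |S| + 1) / k by O(sqrt (log n / n)) times the geometric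
mean of the two values of q, and the lower bound on k^* makes it positive. A union
bound over the pairs (i, j) for a single seed then shows that the greedy
algorithm started at that seed outputs the support.

Hence the output I of SSPCA satisfies lambda_1(I) >= lambda_1(support) >= Q(v).
After whitening, a net of cardinality p^O(k) shows that Q is uniformly close to q
on 2k-sparse vectors, up to O(L + sqrt L) with L of order k log p / n. For the
top eigenvector w = t v + y of Sigma_I, the inequality Q(w) >= Q(v) then forces
|y|^2 = 1 - t^2 = O(sqrt ((1 + beta) L) / beta), whereas t^2 is at most the
proportion of the support that is recovered.
*)
Require Import Defs.
From HB Require Import structures.
From mathcomp Require Import all_boot all_order all_algebra.
From mathcomp Require Import all_classical all_reals all_analysis.
From mathcomp Require Import measurable_realfun zify ring lra.

Set Implicit Arguments.
Unset Strict Implicit.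
Unset Printing Implicit Defensive.
Import Order.TTheory GRing.Theory Num.Theory.
Import numFieldNormedType.Exports.

Local Open Scope classical_set_scope.
Local Open Scope ring_scope.

(** * Products of independent variables *)

Section WeightedIntegral.
Context {R : realType} d d' (T : measurableType d) (T' : measurableType d').
Local Open Scope ereal_scope.
Import HBNNSimple.

(** The identity passes from indicators to simple functions by additivity and to nonnegative
    functions by monotone convergence. The weight [H] serves as a density, as the constant 1, or as
    the product of the remaining independent factors. *)
Lemma ge0_integral_comp_weighted (mu : {measure set T -> \bar R})
    (nu : {measure set T' -> \bar R}) (Y : T -> T') (H : T -> R) (c : R) :
  measurable_fun [set: T] Y -> measurable_fun [set: T] H ->
  (forall x, (0 <= H x)%R) -> (0 <= c)%R ->
  (forall A, measurable A -> \int[mu]_x ((\1_A (Y x))%:E * (H x)%:E) = c%:E * nu A) ->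
  forall f : T' -> \bar R, measurable_fun [set: T'] f -> (forall y, 0 <= f y) ->
  \int[mu]_x (f (Y x) * (H x)%:E) = c%:E * \int[nu]_y f y.
Proof.
move=> mY mH H0 c0 muA f mf f0.
have mEH : measurable_fun [set: T] (EFin \o H) by exact/measurable_EFinP.
have HE0 x : 0 <= (H x)%:E by rewrite lee_fin.
have indic (h : {nnsfun T' >-> R}) :
    \int[mu]_x ((h (Y x))%:E * (H x)%:E) = c%:E * \int[nu]_y (h y)%:E.
  have E x : (h (Y x))%:E * (H x)%:E =
      \sum_(r \in range h) (r%:E * ((\1_(h @^-1` [set r]) (Y x))%:E * (H x)%:E)).
    rewrite fimfunE -fsumEFin// ge0_mule_fsuml; last first.
      by move=> r; rewrite EFinM nnfun_muleindic_ge0.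
    by apply: eq_fsbigr => r _; rewrite EFinM muleA.
  under eq_integral do rewrite E.
  have m1 r : measurable_fun [set: T]
      (fun x => (\1_(h @^-1` [set r]) (Y x))%:E * (H x)%:E).
    apply: emeasurable_funM => //; apply/measurable_EFinP.
    have mI : measurable_fun [set: T'] (\1_(h @^-1` [set r]) : T' -> R) by [].
    exact: measurableT_comp mI mY.
  rewrite ge0_integral_fsum//; last 2 first.
  - by move=> r; exact: measurable_funeM.
  - move=> r x _; rewrite muleA mule_ge0// nnfun_muleindic_ge0//.
  rewrite integralT_nnsfun sintegralE ge0_mule_fsumr; last first.
    by move=> r; exact: nnsfun_mulemu_ge0.
  apply: eq_fsbigr => r /set_mem [y _ <-].
  rewrite ge0_integralZl//; last 2 first.
  - by move=> x _; rewrite mule_ge0// lee_fin.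
  - by rewrite lee_fin.
  by rewrite muA// muleCA.
pose g := nnsfun_approx measurableT mf.
have limg y : f y = limn (fun n => (g n y)%:E).
  by apply/esym/cvg_lim => //; exact: cvg_nnsfun_approx.
have ndg x : {homo (fun n => (g n x)%:E) : n m / (n <= m)%O >-> n <= m}.
  by move=> a b ab; rewrite lee_fin; exact/lefP/nd_nnsfun_approx.
transitivity (limn (fun n => \int[mu]_x ((g n (Y x))%:E * (H x)%:E))).
  rewrite -monotone_convergence//=.
  - apply: eq_integral => x _; apply/esym/cvg_lim => //.
    by apply: cvgeZr => //; exact: cvg_nnsfun_approx.
  - move=> n; apply: emeasurable_funM => //.
    apply/measurable_EFinP; exact: measurableT_comp.
  - by move=> n x _; rewrite mule_ge0// lee_fin.
  - by move=> x _ a b ab; rewrite lee_wpmul2r// ndg.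
under eq_fun do rewrite indic.
have ndi : {homo (fun n => \int[nu]_x (g n x)%:E) : n m / (n <= m)%O >-> n <= m}.
  move=> a b ab; apply: ge0_le_integral => //=.
  - by move=> x _; rewrite lee_fin.
  - exact/measurable_EFinP.
  - exact/measurable_EFinP.
  - by move=> x _; exact: ndg.
rewrite limeMl//; last exact: ereal_nondecreasing_is_cvgn.
congr (_ * _); rewrite -monotone_convergence//=.
- by apply: eq_integral => y _; rewrite limg.
- by move=> n; exact/measurable_EFinP.
- by move=> n x _; rewrite lee_fin.
Qed.

End WeightedIntegral.

Section IndependentProduct.
Context {R : realType} d d' (T : measurableType d) (T' : measurableType d').
Variable P : probability T R.
Local Open Scope ereal_scope.

Lemma measurable_all_preimage (n : nat) (Y : 'I_n -> T -> T') (A : 'I_n -> set T') :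
  (forall i, measurable_fun [set: T] (Y i)) -> (forall i, measurable (A i)) ->
  measurable [set w | forall i, A i (Y i w)].
Proof.
move=> mY mA.
rewrite (_ : [set w | _] = \bigcap_(i in [set: 'I_n]) (Y i @^-1` A i)).
  apply: fin_bigcap_measurable => // i _.
  by rewrite -[X in measurable X]setTI; exact: mY.
by apply/seteqP; split => w /= H i => [_|]; exact: H.
Qed.

Lemma measurable_fun_prodr I (s : seq I) (Q : pred I) (f : I -> T -> R) :
  (forall i, measurable_fun [set: T] (f i)) ->
  measurable_fun [set: T] (fun w => \prod_(i <- s | Q i) f i w)%R.
Proof.
move=> mf; elim: s => [|i s IHs].
  by (under eq_fun do rewrite big_nil); exact: measurable_cst.
under eq_fun do rewrite big_cons.
by case: (Q i); [exact: measurable_funM (mf i) IHs|exact: IHs].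
Qed.

Lemma mutually_independent_integral_prod (n : nat) (Y : 'I_n -> T -> T')
    (h : 'I_n -> T' -> R) (c : 'I_n -> R) :
  (forall i, measurable_fun [set: T] (Y i)) ->
  mutually_independent P Y ->
  (forall i, measurable_fun [set: T'] (h i)) ->
  (forall i y, (0 <= h i y)%R) ->
  (forall i, \int[P]_w (h i (Y i w))%:E = (c i)%:E) ->
  \int[P]_w (\prod_(i < n) h i (Y i w))%:E = (\prod_(i < n) c i)%:E.
Proof.
move=> mY indY.
have mYA i A : measurable A -> measurable (Y i @^-1` A).
  by move=> mA; rewrite -[X in measurable X]setTI; exact: mY.
(* Induction on the number of factors that are not indicator functions. *)
suff step m : (forall i : 'I_n, (m <= i)%N ->
      exists2 A : set T', measurable A & h i = \1_A :> (T' -> R)) ->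
    (forall i, measurable_fun [set: T'] (h i)) ->
    (forall i y, (0 <= h i y)%R) ->
    (forall i, \int[P]_w (h i (Y i w))%:E = (c i)%:E) ->
    \int[P]_w (\prod_(i < n) h i (Y i w))%:E = (\prod_(i < n) c i)%:E.
  by apply: (step n) => i; rewrite leqNgt ltn_ord.
elim: m h c => [|m IHm] h c hI mh h0 hc.
  have /choice [A hA] : forall i : 'I_n,
      exists A : set T', measurable A /\ h i = \1_A :> (T' -> R).
    by move=> i; have [A mA ->] := hI i isT; exists A.
  have mA i : measurable (A i) by case: (hA i).
  have hE i : h i = \1_(A i) by case: (hA i).
  have cE i : P (Y i @^-1` A i) = (c i)%:E.
    rewrite -hc; under eq_integral do rewrite hE.
    by rewrite -[LHS](congr1 _ (setIT _)) -integral_indic//; exact: mYA.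
  transitivity (\int[P]_w (\1_[set w | forall i, A i (Y i w)] w : R)%:E).
    apply: eq_integral => w _; congr (_%:E).
    rewrite indicE; under eq_bigr do rewrite hE indicE.
    have [Aw|nAw] := pselect (forall i, A i (Y i w)).
      rewrite mem_set//= big1// => i _; rewrite mem_set//; exact: Aw.
    rewrite memNset//=; move/existsNP: nAw => [i nAi].
    by rewrite (bigD1 i)//= memNset// mul0r.
  rewrite integral_indic//; last exact: measurable_all_preimage.
  rewrite setIT; apply: (etrans (indY A mA)).
  by rewrite -prodEFin; apply: eq_bigr => i _; rewrite -cE.
have [nm|mn] := leqP n m.
  by apply: IHm => // i mi; have := leq_trans nm mi; rewrite leqNgt ltn_ord.
(* The other factors act as a weight for factor [j]. By the weighted change of variables it suffices
   to replace [h j] by an indicator, which leaves one factor fewer for the induction. *)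
pose j := Ordinal mn.
have j_rest (g : 'I_n -> T' -> R) : (forall i, i != j -> g i = h i) ->
    forall w, (\prod_(i < n | i != j) g i (Y i w) =
      \prod_(i < n | i != j) h i (Y i w))%R.
  by move=> gh w; apply: eq_bigr => i ij; rewrite gh.
under eq_integral do rewrite (bigD1 j)//= EFinM.
rewrite (bigD1 j)//= mulrC EFinM -hc.
have -> : \int[P]_w (h j (Y j w))%:E = \int[pushforward P (Y j)]_y (h j y)%:E.
  rewrite ge0_integral_pushforward//=.
    exact/measurable_EFinP.
  by move=> y _; rewrite lee_fin.
apply: (@ge0_integral_comp_weighted _ _ _ _ _ P (pushforward P (Y j)) (Y j)
  (fun w => \prod_(i < n | i != j) h i (Y i w))%R _ _ _ _ _ _ (EFin \o h j)).
- exact: mY.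
- by apply: measurable_fun_prodr => i; exact: measurableT_comp (mh i) (mY i).
- by move=> w; apply: prodr_ge0 => i _.
- apply: prodr_ge0 => i _; rewrite -lee_fin -hc.
  by apply: integral_ge0 => w _; rewrite lee_fin.
- move=> A mA.
  pose g i := if i == j then \1_A else h i.
  pose e i := if i == j then fine (P (Y j @^-1` A)) else c i.
  have gh i : i != j -> g i = h i by rewrite /g => /negbTE ->.
  have := IHm g e; rewrite (bigD1 j)//=.
  rewrite {2}/e eqxx (eq_bigr c); last by move=> i /negbTE ij; rewrite /e ij.
  rewrite mulrC EFinM fineK ?fin_num_measure//; last exact: mYA.
  move=> <-//.
  + apply: eq_integral => w _; rewrite [in RHS](bigD1 j)//= EFinM /g eqxx.
    by rewrite -(j_rest _ gh).
  + move=> i mi; rewrite /g; have [_|ij] := eqVneq i j; first by exists A.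
    apply: hI; rewrite ltn_neqAle mi andbT; apply: contra_neq ij => mi'.
    exact: val_inj.
  + by move=> i; rewrite /g; case: ifP.
  + by move=> i y; rewrite /g; case: ifP => // _; rewrite indicE.
  + move=> i; rewrite /g /e; have [->|_] := eqVneq i j; last exact: hc.
    rewrite fineK ?fin_num_measure//; last exact: mYA.
    rewrite -[RHS](congr1 _ (setIT _)) -integral_indic//; exact: mYA.
- exact/measurable_EFinP.
- by move=> y; rewrite lee_fin.
Qed.

End IndependentProduct.

(** * Concentration of quadratic forms *)

Section ChiSquare.
Context {R : realType}.

Lemma integral_normal_probE (s : R) (f : R -> \bar R) :
  measurable_fun [set: R] f -> (forall y, (0 <= f y)%E) ->
  (\int[normal_prob 0 s]_y f y =
   \int[lebesgue_measure]_y (f y * (normal_pdf 0 s y)%:E))%E.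
Proof.
move=> mf f0.
rewrite -[LHS]mul1e; apply/esym.
apply: (@ge0_integral_comp_weighted _ _ _ _ _ lebesgue_measure (normal_prob 0 s)
  idfun (normal_pdf 0 s) 1) => //.
- exact: measurable_id.
- exact: measurable_normal_pdf.
- by move=> y; exact: normal_pdf_ge0.
- move=> A mA; rewrite mul1e [RHS]integral_mkcond.
  apply: eq_integral => y _ /=; rewrite patchE indicE.
  by case: ifP => _; rewrite ?mul1e ?mul0e.
Qed.

(** The tilted density is a multiple of the centered normal density of variance [q / (1 - 2 * mu)],
    whose integral is 1. *)
Lemma normal_square_mgf (q mu : R) : 0 < q -> mu < 2^-1 ->
  (\int[normal_prob 0 (Num.sqrt q)]_y (expR (mu / q * y ^+ 2))%:E =
   ((Num.sqrt (1 - 2 * mu))^-1)%:E)%E.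
Proof.
move=> q0 mu2.
have m0 : 0 < 1 - 2 * mu by lra.
have sq0 : 0 < Num.sqrt q by rewrite sqrtr_gt0.
pose s' := Num.sqrt (q / (1 - 2 * mu)).
have s'0 : 0 < s' by rewrite sqrtr_gt0 divr_gt0.
rewrite integral_normal_probE//; last first.
  apply/measurable_EFinP; apply: measurableT_comp => //.
  by apply: measurable_funM => //; exact: measurable_funX.
transitivity (\int[lebesgue_measure]_y
    (((Num.sqrt (1 - 2 * mu))^-1)%:E * (normal_pdf 0 s' y)%:E))%E.
  apply: eq_integral => y _; rewrite -!EFinM; congr (_%:E).
  rewrite !normal_pdfE ?gt_eqF// /normal_peak /normal_fun.
  rewrite !sqr_sqrtr ?ltW ?divr_gt0//.
  rewrite [LHS]mulrCA -expRD [RHS]mulrA -invfM; congr (_ * _).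
    congr (_^-1); rewrite -sqrtrM ?ltW//; congr Num.sqrt.
    by field; rewrite gt_eqF.
  congr expR; rewrite subr0; field; rewrite gt_eqF//= gt_eqF//.
rewrite ge0_integralZl//=; first by rewrite integral_normal_pdf mule1.
- by apply/measurable_EFinP; exact: measurable_normal_pdf.
- by move=> y _; rewrite lee_fin normal_pdf_ge0.
Qed.

(** After squaring, [1 + x <= expR x] reduces the claim to (1 + 2 mu + 8 mu^2) (1 - 2 mu) = 1 + 4
    mu^2 (1 - 4 mu) >= 1, whence the threshold 1/4. *)
Lemma inv_sqrt_le_expR (mu : R) : mu <= 4^-1 ->
  (Num.sqrt (1 - 2 * mu))^-1 <= expR (mu + 4 * mu ^+ 2).
Proof.
move=> mu4; have m0 : 0 < 1 - 2 * mu by lra.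
rewrite -div1r ler_pdivrMr ?sqrtr_gt0//.
set r := _ * _; suff : 1 ^+ 2 <= r ^+ 2 by rewrite ler_pXn2r// nnegrE ?mulr_ge0 ?expR_ge0 ?sqrtr_ge0.
rewrite expr1n exprMn (sqr_sqrtr (ltW m0)) -expRM_natl.
have hE := expR_ge1Dx (2 * (mu + 4 * mu ^+ 2)).
apply: (@le_trans _ _ ((1 + 2 * (mu + 4 * mu ^+ 2)) * (1 - 2 * mu))); first nra.
by rewrite ler_pM2r.
Qed.

Section Concentration.
Context d (T : measurableType d) (P : probability T R) (n : nat).
Variables (Y : 'I_n -> T -> R) (q : R).
Hypothesis mY : forall i, measurable_fun [set: T] (Y i).
Hypothesis indY : mutually_independent P Y.
Hypothesis q0 : 0 < q.
Hypothesis lawY : forall i (B : set R), measurable B ->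
  P (Y i @^-1` B) = normal_law 0 q B.

Lemma integral_expR_sum_squares (mu : R) : mu < 2^-1 ->
  (\int[P]_w (expR (mu * (\sum_(i < n) Y i w ^+ 2 / q)))%:E =
   ((Num.sqrt (1 - 2 * mu))^-1 ^+ n)%:E)%E.
Proof.
move=> mu2.
have -> : (Num.sqrt (1 - 2 * mu))^-1 ^+ n =
    \prod_(i < n) (Num.sqrt (1 - 2 * mu))^-1 by rewrite prodr_const card_ord.
have mf : measurable_fun [set: R] (fun y : R => expR (mu / q * y ^+ 2)).
  apply: measurableT_comp => //.
  by apply: measurable_funM => //; exact: measurable_funX.
rewrite -(@mutually_independent_integral_prod _ _ _ _ _ P n Y
  (fun _ y => expR (mu / q * y ^+ 2)))//.
- apply: eq_integral => w _; rewrite -expR_sum; congr (expR _)%:E.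
  by rewrite mulr_sumr; apply: eq_bigr => i _; ring.
- move=> i; rewrite -(normal_square_mgf q0)//.
  rewrite -[RHS]mul1e -(@ge0_integral_comp_weighted _ _ _ _ _ P
    (normal_prob 0 (Num.sqrt q)) (Y i) (cst 1) 1 _ _ _ _ _
    (fun y => (expR (mu / q * y ^+ 2))%:E))//.
  + by apply: eq_integral => w _; rewrite mule1.
  + exact: mY.
  + move=> A mA; under eq_integral do rewrite mule1.
    rewrite mul1e.
    have := lawY i mA; rewrite /normal_law gt_eqF//; apply: etrans.
    rewrite -[X in _ = P X]setIT -integral_indic//.
    by rewrite -[X in measurable X]setTI; exact: mY.
  + exact/measurable_EFinP.
Qed.

Lemma measurable_sum_squares (mu : R) :
  measurable_fun [set: T] (fun w => mu * (\sum_(i < n) Y i w ^+ 2 / q)).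
Proof.
apply: measurable_funM => //.
apply: measurable_sum => i; apply: measurable_funM => //.
exact: measurable_funX.
Qed.

Lemma measurable_sum_squares_ge (mu r : R) :
  measurable [set w | r <= mu * (\sum_(i < n) Y i w ^+ 2 / q)].
Proof.
rewrite -[X in measurable X]setTI.
by apply: measurable_fun_le => //; exact: measurable_sum_squares.
Qed.

(** Markov's inequality for the exponential of the right-hand side of the event. The sign of [mu]
    selects the upper or the lower tail. *)
Lemma sum_squares_chernoff (mu t : R) : mu <= 4^-1 ->
  (P [set w | mu * n%:R + t <= mu * (\sum_(i < n) Y i w ^+ 2 / q)]%R <=
   (expR (4 * mu ^+ 2 * n%:R - t))%:E)%E.
Proof.
move=> mu4.
set A := [set w | _].
pose F w := expR (mu * (\sum_(i < n) Y i w ^+ 2 / q)).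
have mF : measurable_fun [set: T] F.
  by apply: measurableT_comp => //; exact: measurable_sum_squares.
have mA : measurable A by exact: measurable_sum_squares_ge.
have key : ((expR (mu * n%:R + t))%:E * P A <= \int[P]_w (F w)%:E)%E.
  rewrite -integral_cst//.
  apply: (@le_trans _ _ (\int[P]_(w in A) (F w)%:E)%E).
    apply: ge0_le_integral => //=.
    - by apply/measurable_EFinP; exact: measurable_funTS.
    - by move=> w Aw; rewrite lee_fin ler_expR.
  apply: ge0_subset_integral => //; first exact/measurable_EFinP.
  by move=> w _; rewrite lee_fin expR_ge0.
rewrite integral_expR_sum_squares in key; last by lra.
rewrite -(@lee_pmul2l _ (expR (mu * n%:R + t))%:E) ?lte_fin ?expR_gt0//.
apply: (le_trans key); rewrite lee_fin -expRD.
have /(lerXn2r n) : (Num.sqrt (1 - 2 * mu))^-1 <= expR (mu + 4 * mu ^+ 2).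
  exact: inv_sqrt_le_expR.
rewrite ?nnegrE invr_ge0 sqrtr_ge0 expR_ge0 => /(_ isT isT)/le_trans; apply.
by rewrite -expRM_natl ler_expR; lra.
Qed.

(* The two tails are the cases mu = eta / 8 and mu = - eta / 8. *)
Lemma sum_squares_concentration (eta delta : R) : (0 < n)%N ->
  0 <= eta <= 1 -> eta <= delta ->
  measurable [set w | `|n%:R^-1 * \sum_(i < n) Y i w ^+ 2 - q| <= delta * q] /\
  (P (~` [set w | `|n%:R^-1 * \sum_(i < n) Y i w ^+ 2 - q| <= delta * q]%R) <=
   (2 * expR (- (n%:R * (eta * delta) / 16)))%:E)%E.
Proof.
move=> n_gt0 /andP[eta0 eta1] ed; set E := [set w | _].
have mE : measurable E.
  rewrite -[E]setTI; apply: measurable_fun_le => //.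
  apply: measurableT_comp => //; apply: measurable_funB => //.
  apply: measurable_funM => //; apply: measurable_sum => i.
  exact: measurable_funX.
split => //.
have n0 : 0 < (n%:R : R) by rewrite ltr0n.
pose A (mu : R) := [set w | mu * n%:R + eta / 8 * delta * n%:R <=
  mu * (\sum_(i < n) Y i w ^+ 2 / q)].
have mA mu : measurable (A mu) by exact: measurable_sum_squares_ge.
have PA mu : mu <= 4^-1 -> mu ^+ 2 = (eta / 8) ^+ 2 ->
    (P (A mu) <= (expR (- (n%:R * (eta * delta) / 16)))%:E)%E.
  move=> mu4 mu2; apply: (le_trans (sum_squares_chernoff _ mu4)).
  (* With t = eta delta n / 8, the quadratic term 4 mu^2 n = eta^2 n / 16 is at most t / 2 because
     eta <= delta. *)
  rewrite lee_fin ler_expR mu2.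
  have : 0 <= n%:R * (eta * (delta - eta)).
    by rewrite mulr_ge0// mulr_ge0// subr_ge0.
  lra.
have EA : ~` E `<=` A (eta / 8) `|` A (- (eta / 8)).
  move=> w /= /negP; rewrite -ltNge; set S := \sum_(i < n) _ => h.
  rewrite /A /= -!mulr_suml -/S.
  have -> : S = (n%:R^-1 * S) * n%:R by rewrite mulrC mulVKf// gt_eqF.
  move: h; set s := n%:R^-1 * S => h.
  have sE : s - q = q * (s / q - 1).
    by rewrite mulrBr mulr1 mulrCA divff ?mulr1// gt_eqF.
  have h' : delta < `|s / q - 1|.
    by rewrite -(ltr_pM2r q0) (lt_le_trans h)// sE normrM gtr0_norm// mulrC.
  have -> : s * n%:R / q = s / q * n%:R by rewrite mulrAC.
  move: h'; set r := s / q => h'.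
  have en : 0 <= eta / 8 * n%:R by rewrite mulr_ge0// divr_ge0.
  have [r1|r1] := leP 0 (r - 1).
    left; rewrite ger0_norm// in h'.
    have : 0 <= (eta / 8 * n%:R) * (r - 1 - delta) by rewrite mulr_ge0// subr_ge0 ltW.
    lra.
  right; rewrite ltr0_norm// in h'.
  have : 0 <= (eta / 8 * n%:R) * (1 - r - delta) by rewrite mulr_ge0//; lra.
  lra.
apply: (@le_trans _ _ (P (A (eta / 8) `|` A (- (eta / 8))))).
  by apply: le_measure => //; rewrite inE//; [exact: measurableC|exact: measurableU].
apply: le_trans; first by apply: measureU2; exact: mA.
rewrite mulrDl mul1r EFinD; apply: leeD; apply: PA; rewrite ?sqrrN//; lra.
Qed.

End Concentration.
End ChiSquare.

(** * Bilinear forms, Cauchy-Schwarz and the sample covariance *)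

Section QuadraticForm.
Context {R : realType}.
Implicit Types p : nat.

Definition bform p (M : 'M[R]_p) (a b : 'rV[R]_p) : R := (a *m M *m b^T) 0 0.

Lemma bformDl p (M : 'M[R]_p) a b c : bform M (a + b) c = bform M a c + bform M b c.
Proof. by rewrite /bform !mulmxDl mxE. Qed.

Lemma bformDr p (M : 'M[R]_p) a b c : bform M a (b + c) = bform M a b + bform M a c.
Proof. by rewrite /bform linearD/= mulmxDr mxE. Qed.

Lemma bformZl p (M : 'M[R]_p) t a b : bform M (t *: a) b = t * bform M a b.
Proof. by rewrite /bform -!scalemxAl mxE. Qed.

Lemma bformZr p (M : 'M[R]_p) t a b : bform M a (t *: b) = t * bform M a b.
Proof. by rewrite /bform linearZ/= -scalemxAr mxE. Qed.

Lemma bform0l p (M : 'M[R]_p) a : bform M 0 a = 0.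
Proof. by rewrite /bform !mul0mx mxE. Qed.

Lemma bformC p (M : 'M[R]_p) a b : M^T = M -> bform M a b = bform M b a.
Proof.
move=> sM; rewrite /bform; transitivity ((a *m M *m b^T)^T 0 0).
  by rewrite [RHS]mxE.
by rewrite !trmx_mul trmxK sM mulmxA.
Qed.

Lemma bformB p (M N : 'M[R]_p) a b : bform (M - N) a b = bform M a b - bform N a b.
Proof. by rewrite /bform mulmxBr mulmxBl !mxE. Qed.

Lemma bform_lin2 p (M : 'M[R]_p) (s t : R) a b : M^T = M ->
  bform M (s *: a + t *: b) (s *: a + t *: b) =
  s ^+ 2 * bform M a a + 2 * (s * t) * bform M a b + t ^+ 2 * bform M b b.
Proof.
move=> sM; rewrite !bformDl !bformDr !bformZl !bformZr (bformC b a sM); ring.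
Qed.

Lemma bform_conj m p (M : 'M[R]_p) (T : 'M[R]_(m, p)) a b :
  bform (T *m M *m T^T) a b = bform M (a *m T) (b *m T).
Proof. by rewrite /bform trmx_mul !mulmxA. Qed.

Lemma bformE p (M : 'M[R]_p) a b :
  bform M a b = \sum_i \sum_j a 0 i * M i j * b 0 j.
Proof.
rewrite /bform mxE exchange_big/=; apply: eq_bigr => j _.
by rewrite !mxE mulr_suml.
Qed.

Definition sqnorm p (a : 'rV[R]_p) : R := \sum_i a 0 i ^+ 2.

Definition dotp p (a b : 'rV[R]_p) : R := \sum_i a 0 i * b 0 i.

Lemma bform1 p (a b : 'rV[R]_p) : bform 1%:M a b = dotp a b.
Proof. by rewrite /bform mulmx1 mxE; apply: eq_bigr => i _; rewrite mxE. Qed.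

Lemma dotpp p (a : 'rV[R]_p) : dotp a a = sqnorm a.
Proof. by []. Qed.

Lemma sqnorm_ge0 p (a : 'rV[R]_p) : 0 <= sqnorm a.
Proof. by apply: sumr_ge0 => i _; exact: sqr_ge0. Qed.

Lemma sqnorm_eq0 p (a : 'rV[R]_p) : (sqnorm a == 0) = (a == 0).
Proof.
apply/idP/eqP => [|->]; last by rewrite /sqnorm big1// => i _; rewrite mxE expr0n.
rewrite psumr_eq0 => [/allP h|i _]; last exact: sqr_ge0.
apply/rowP => i; rewrite mxE; apply/eqP; rewrite -sqrf_eq0.
by apply: h; rewrite mem_index_enum.
Qed.

Lemma bform_cauchy_schwarz p (M : 'M[R]_p) a b : M^T = M ->
  (forall u, 0 <= bform M u u) -> bform M a b ^+ 2 <= bform M a a * bform M b b.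
Proof.
move=> sM pM.
(* If the form vanishes at [b], its value at a + t b is affine in t and nonnegative, so the slope is
   zero: the t chosen below would give the value -1. *)
have [b0|b0] := eqVneq (bform M b b) 0.
  have H t : 0 <= bform M a a + 2 * t * bform M a b.
    have := pM (1 *: a + t *: b); rewrite bform_lin2// b0; lra.
  have [->|ab0] := eqVneq (bform M a b) 0; first by rewrite expr0n b0 mulr0.
  have := H (- (bform M a a + 1) / (2 * bform M a b)).
  rewrite (_ : 2 * _ * _ = - (bform M a a + 1)); first lra.
  by field.
have b1 : 0 < bform M b b by rewrite lt0r b0 pM.
(* The value at this combination is [bform M b b] times the difference of the two sides. *)
have := pM (bform M b b *: a + (- bform M a b) *: b); rewrite bform_lin2//.
rewrite (_ : _ + _ = bform M b b * (bform M a a * bform M b b - bform M a b ^+ 2)).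
  by rewrite pmulr_rge0// subr_ge0.
ring.
Qed.

Lemma dotp_cauchy_schwarz p (a b : 'rV[R]_p) : dotp a b ^+ 2 <= sqnorm a * sqnorm b.
Proof.
rewrite -!dotpp -!bform1; apply: bform_cauchy_schwarz; first exact: trmx1.
by move=> u; rewrite bform1 sqnorm_ge0.
Qed.

Lemma sample_covariance_sym n p (X : 'M[R]_(n, p)) :
  (sample_covariance X)^T = sample_covariance X.
Proof. by rewrite /sample_covariance linearZ/= trmx_mul trmxK. Qed.

Lemma bform_sample_covariance n p (X : 'M[R]_(n, p)) u :
  bform (sample_covariance X) u u =
  n%:R^-1 * \sum_(i < n) (\sum_(j < p) u 0 j * X i j) ^+ 2.
Proof.
rewrite /bform /sample_covariance -scalemxAr -scalemxAl mxE; congr (_ * _).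
rewrite (_ : _ *m _ *m _ = (X *m u^T)^T *m (X *m u^T)); last first.
  by rewrite trmx_mul trmxK !mulmxA.
rewrite mxE; apply: eq_bigr => i _; rewrite expr2 !mxE.
by congr (_ * _); apply: eq_bigr => j _; rewrite mxE mulrC.
Qed.

End QuadraticForm.

(** * Largest eigenvalue of a principal submatrix *)

Section Rayleigh.
Context {R : realType}.

Lemma continuous_bform m (A : 'M[R]_m) : continuous (fun u : 'rV[R]_m => bform A u u).
Proof.
rewrite (_ : (fun _ => _) =
    (fun u : 'rV[R]_m => \sum_i \sum_j u 0 i * A i j * u 0 j)); last first.
  by apply/funext => w; rewrite bformE.
apply: (continuous_big add_continuous) => i _.
apply: (continuous_big add_continuous) => j _ u.
apply: (continuousM (s := fun u : 'rV[R]_m => u 0 i * A i j)).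
  apply: (continuousM (t := cst (A i j))); last exact: cst_continuous.
  exact: coord_continuous.
exact: coord_continuous.
Qed.

Lemma compact_sphere m : compact [set u : 'rV[R]_m | sqnorm u = 1].
Proof.
apply: bounded_closed_compact.
  exists 1; split => // M M1 u /= u1.
  rewrite /Num.norm/= mx_normrE; apply: bigmax_le => [|[i j] _ /=].
    by rewrite (le_trans _ (ltW M1)).
  apply: le_trans (ltW M1); rewrite -sqrtr_sqr -sqrtr1 ler_sqrt// -u1.
  rewrite ord1 /sqnorm (bigD1 j)//= lerDl; apply: sumr_ge0 => k _.
  exact: sqr_ge0.
rewrite (_ : [set u | _] = (fun u : 'rV[R]_m => bform 1%:M u u) @^-1` [set 1]).
  apply: closed_comp => [u _|]; last exact: closed_eq.
  exact: continuous_bform.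
by apply/seteqP; split => u /=; rewrite bform1 dotpp.
Qed.

(** Compactness gives a maximiser w of the form on the unit sphere. With l the maximum, l - A is
    positive semidefinite and vanishes at w, so Cauchy-Schwarz puts w in its kernel and l is an
    eigenvalue. Rayleigh quotients bound every eigenvalue by l. *)
Lemma lambda1_max m (A : 'M[R]_m) : (0 < m)%N -> A^T = A ->
  (exists2 w : 'rV[R]_m, w != 0 & w *m A = lambda1 A *: w) /\
  forall u, bform A u u <= lambda1 A * sqnorm u.
Proof.
move=> m0 sA.
have nS : [set u : 'rV[R]_m | sqnorm u = 1] !=set0.
  exists (delta_mx 0 (Ordinal m0)) => /=.
  rewrite /sqnorm (bigD1 (Ordinal m0))//= mxE !eqxx expr1n big1 ?addr0// => i.
  by rewrite mxE eqxx => /negbTE ->; rewrite expr0n.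
have cA : {within [set u : 'rV[R]_m | sqnorm u = 1],
    continuous (fun u : 'rV[R]_m => bform A u u)}.
  by apply: continuous_subspaceT; exact: continuous_bform.
have [w /set_mem/= w1 wmax] := EVT_max_rV nS (@compact_sphere m) cA.
pose l := bform A w w.
have lmax u : bform A u u <= l * sqnorm u.
  have [->|u0] := eqVneq u 0.
    by rewrite bform0l (_ : sqnorm 0 = 0) ?mulr0//; apply/eqP; rewrite sqnorm_eq0.
  have un : 0 < sqnorm u by rewrite lt0r sqnorm_eq0 u0 sqnorm_ge0.
  have r0 : 0 < Num.sqrt (sqnorm u) by rewrite sqrtr_gt0.
  have := wmax ((Num.sqrt (sqnorm u))^-1 *: u).
  rewrite inE/= bformZl bformZr mulrA -expr2 exprVn sqr_sqrtr ?sqnorm_ge0//.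
  rewrite mulrC ler_pdivrMr//; apply.
  rewrite -dotpp -bform1 bformZl bformZr mulrA -expr2 exprVn sqr_sqrtr ?sqnorm_ge0//.
  by rewrite bform1 dotpp mulVf// gt_eqF.
pose M := l%:M - A.
have sM : M^T = M by rewrite /M linearB/= tr_scalar_mx sA.
have ME u b : bform M u b = l * dotp u b - bform A u b.
  by rewrite /M bformB; congr (_ - _); rewrite -bform1 /bform mul_mx_scalar
    mulmx1 -scalemxAl mxE.
have pM u : 0 <= bform M u u by rewrite ME subr_ge0 dotpp.
have Mw : bform M w w = 0 by rewrite ME dotpp w1 mulr1 subrr.
have wM : w *m A = l *: w.
  apply/eqP; rewrite eq_sym -subr_eq0 -mul_mx_scalar -mulmxBr; apply/eqP/rowP => i.
  have := bform_cauchy_schwarz w (delta_mx 0 i) sM pM.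
  rewrite Mw mul0r => h; rewrite [RHS]mxE; apply/eqP; rewrite -sqrf_eq0 eq_le sqr_ge0 andbT.
  apply: le_trans h; rewrite (_ : bform M w _ = (w *m M) 0 i)//.
  by rewrite /bform trmx_delta -colE [LHS]mxE.
have w0 : w != 0 by rewrite -sqnorm_eq0 w1 oner_neq0.
have eigl (a : R) : eigenvalue A a -> a <= l.
  move=> /eigenvalueP[u uA u0].
  have un : 0 < sqnorm u by rewrite lt0r sqnorm_eq0 u0 sqnorm_ge0.
  have := lmax u; rewrite /bform uA -scalemxAl mxE.
  have -> : (u *m u^T) 0 0 = sqnorm u by rewrite -dotpp -bform1 /bform mulmx1.
  by rewrite ler_pM2r.
suff lE : l = lambda1 A by rewrite -lE; split => //; exists w.
apply/eqP; rewrite eq_le; apply/andP; split.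
  apply: ub_le_sup => /=; first by exists l.
  by apply/eigenvalueP; exists w.
apply: ge_sup => //=; exists l; by apply/eigenvalueP; exists w.
Qed.

Section PrincipalSubmatrix.
Variables (p : nat) (S : {set 'I_p}).

Definition supported_on (u : 'rV[R]_p) := forall j, j \notin S -> u 0 j = 0.

(** The coordinate selection matrix of [S]: its rows are orthonormal, multiplication by it on the
    right extends a row by zero outside [S], and conjugation by it extracts the principal
    submatrix. *)
Let E : 'M[R]_(#|S|, p) := \matrix_(i, j) (enum_val i == j)%:R.

Let mulEt m (A : 'M[R]_(m, p)) i j : (A *m E^T) i j = A i (enum_val j).
Proof.
rewrite mxE (bigD1 (enum_val j))//= !mxE eqxx mulr1 big1 ?addr0// => k kj.
by rewrite !mxE eq_sym (negbTE kj) mulr0.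
Qed.

Let principal_submatrixE (A : 'M[R]_p) : principal_submatrix A S = E *m A *m E^T.
Proof.
apply/matrixP => i j; rewrite mulEt [LHS]mxE.
by rewrite -[E *m A]trmxK trmx_mul [RHS]mxE mulEt mxE.
Qed.

Let EEt : E *m E^T = 1%:M.
Proof. by apply/matrixP => i j; rewrite mulEt !mxE (inj_eq enum_val_inj). Qed.

Let sqnormE w : sqnorm (w *m E) = sqnorm w.
Proof. by rewrite -!dotpp -!bform1 -bform_conj mulmx1 EEt. Qed.

Let supported_onE w : supported_on (w *m E).
Proof.
move=> j jS; rewrite mxE big1// => i _; rewrite mxE.
case: eqP => [ij|_]; last exact: mulr0.
by move: jS; rewrite -ij enum_valP.
Qed.

Let supported_onK u : supported_on u -> u *m E^T *m E = u.
Proof.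
move=> uS; apply/rowP => j; have [jS|jS] := boolP (j \in S); last first.
  by rewrite uS// supported_onE.
rewrite mxE (bigD1 (enum_rank_in jS j))//= mulEt mxE enum_rankK_in// eqxx mulr1.
rewrite big1 ?addr0// => i ij; rewrite [E _ _]mxE; case: eqP => [eij|_].
  by have := congr1 (enum_rank_in jS) eij; rewrite enum_valK_in => /eqP; rewrite (negbTE ij).
by rewrite mulr0.
Qed.

Lemma f_lambda1_max (A : 'M[R]_p) : (0 < #|S|)%N -> A^T = A ->
  (exists w, [/\ supported_on w, sqnorm w = 1 & bform A w w = f_lambda1 A S]) /\
  forall u, supported_on u -> bform A u u <= f_lambda1 A S * sqnorm u.
Proof.
move=> S0 sA; rewrite /f_lambda1; set l := lambda1 _.
have sP : (principal_submatrix A S)^T = principal_submatrix A S.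
  by rewrite principal_submatrixE !trmx_mul trmxK sA mulmxA.
have [[w w0 wl] lmax] := lambda1_max S0 sP.
split=> [|u uS]; last first.
  rewrite -{1 2}(supported_onK uS) -bform_conj -principal_submatrixE.
  by rewrite (le_trans (lmax _))// -{2}(supported_onK uS) sqnormE.
have n0 : 0 < sqnorm w by rewrite lt0r sqnorm_eq0 w0 sqnorm_ge0.
have r2 : (Num.sqrt (sqnorm w))^-1 ^+ 2 * sqnorm w = 1.
  by rewrite exprVn sqr_sqrtr ?sqnorm_ge0// mulVf// gt_eqF.
exists (((Num.sqrt (sqnorm w))^-1 *: w) *m E); split.
- exact: supported_onE.
- by rewrite sqnormE -dotpp -bform1 bformZl bformZr mulrA -expr2 bform1 dotpp.
- rewrite -bform_conj -principal_submatrixE bformZl bformZr mulrA -expr2.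
  have wwE : (w *m w^T) 0 0 = sqnorm w by rewrite -dotpp -bform1 /bform mulmx1.
  by rewrite /bform wl -scalemxAl mxE wwE mulrCA r2 mulr1.
Qed.

End PrincipalSubmatrix.

End Rayleigh.

(** * The population covariance and concentration in a fixed direction *)

Section SpikedCovariance.
Context {R : realType}.

Definition spiked_cov p (beta : R) (v : 'cV[R]_p) : 'M[R]_p :=
  beta *: (v *m v^T) + 1%:M.

Lemma spiked_cov_sym p beta (v : 'cV[R]_p) : (spiked_cov beta v)^T = spiked_cov beta v.
Proof. by rewrite /spiked_cov linearD/= linearZ/= trmx_mul trmxK trmx1. Qed.

Lemma bform_spiked_cov p beta (v : 'cV[R]_p) a b :
  bform (spiked_cov beta v) a b = beta * (dotp a v^T * dotp b v^T) + dotp a b.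
Proof.
rewrite -[dotp a b]bform1 /bform /spiked_cov mulmxDr mulmxDl mxE; congr (_ + _).
rewrite -scalemxAr -scalemxAl mxE; congr (_ * _).
rewrite (mulmxA a v) -mulmxA mxE big_ord1; congr (_ * _); rewrite mxE.
  by apply: eq_bigr => i _; rewrite mxE.
by apply: eq_bigr => i _; rewrite !mxE mulrC.
Qed.

Lemma spiked_cov_ge p beta (v : 'cV[R]_p) a : 0 <= beta ->
  sqnorm a <= bform (spiked_cov beta v) a a.
Proof.
by move=> b0; rewrite bform_spiked_cov dotpp lerDr mulr_ge0// -expr2 sqr_ge0.
Qed.

Section Model.
Context d (T : measurableType d) (P : probability T R) (n p k : nat) (beta : R).
Variables (v : 'cV[R]_p) (x : 'I_n -> {mfun T >-> p.-tuple R}).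
Hypothesis model : UBSPCA P k beta v x.

Let Sigma w := sample_covariance (data_matrix x w).

Definition concentrated_at (delta : R) (u : 'rV[R]_p) (M : 'M[R]_p) : Prop :=
  `|bform M u u - bform (spiked_cov beta v) u u| <=
    delta * bform (spiked_cov beta v) u u.

Lemma UBSPCA_concentration (u : 'rV[R]_p) (eta delta : R) : (0 < n)%N ->
  0 <= eta <= 1 -> eta <= delta ->
  measurable [set w | concentrated_at delta u (Sigma w)] /\
  (P (~` [set w | concentrated_at delta u (Sigma w)]) <=
   (2 * expR (- (n%:R * (eta * delta) / 16)))%:E)%E.
Proof.
case: model => beta0 _ ind gauss n0 eta01 ed.
(* At [u = 0] the variance is zero, outside of the scope of the chi-square bound, but the event is
   then the whole space. *)
have [->|u0] := eqVneq u 0.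
  have -> : [set w | concentrated_at delta 0 (Sigma w)] = setT.
    by apply/seteqP; split => // w _; rewrite /= /concentrated_at !bform0l subr0 mulr0 normr0.
  by split => //; rewrite setCT measure0 lee_fin mulr_ge0// expR_ge0.
set q := bform (spiked_cov beta v) u u.
have q0 : 0 < q.
  by apply: lt_le_trans (spiked_cov_ge v u beta0); rewrite lt0r sqnorm_eq0 u0 sqnorm_ge0.
pose Y (i : 'I_n) (w : T) : R := \sum_(j < p) u 0 j * tnth (x i w) j.
have mlin : measurable_fun [set: p.-tuple R]
    (fun y : p.-tuple R => \sum_(j < p) u 0 j * tnth y j).
  apply: measurable_sum => j; apply: measurable_funM => //.
  exact: measurable_tnth.
have mY i : measurable_fun [set: T] (Y i) by exact: measurableT_comp mlin _.
have indY : mutually_independent P Y.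
  move=> A mA.
  pose B i := (fun y : p.-tuple R => \sum_(j < p) u 0 j * tnth y j) @^-1` A i.
  apply: (ind B) => i.
  by rewrite -[B i]setTI; exact: mlin.
have lawY i (B : set R) : measurable B -> P (Y i @^-1` B) = normal_law 0 q B.
  by move=> mB; exact: gauss.
have := sum_squares_concentration mY indY q0 lawY n0 eta01 ed.
rewrite /concentrated_at -/q.
have SE w : bform (Sigma w) u u = n%:R^-1 * \sum_(i < n) Y i w ^+ 2.
  rewrite /Sigma bform_sample_covariance; congr (_ * _).
  apply: eq_bigr => i _; congr (_ ^+ 2); apply: eq_bigr => j _; rewrite mxE//.
have -> : [set w | `|bform (Sigma w) u u - q| <= delta * q] =
    [set w | `|n%:R^-1 * \sum_(i < n) Y i w ^+ 2 - q| <= delta * q].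
  by apply/seteqP; split => w /=; rewrite SE.
by [].
Qed.

End Model.

End SpikedCovariance.

(** * Uniform concentration on sparse vectors *)

Section SparseNet.
Context {R : realType}.
Variable p : nat.
Implicit Types (a b u : 'rV[R]_p) (J : {set 'I_p}) (N s : nat).

Definition grid N : seq R := [seq (i%:R - N%:R) / N%:R | i <- iota 0 (2 * N).+1].

(** Rounding down to a multiple of 1/N; the shift by N makes the truncated number nonnegative for t
    in [-1, 1]. *)
Definition grid_round N (t : R) : R := ((Num.truncn (N%:R * t + N%:R))%:R - N%:R) / N%:R.

Lemma grid_round_mem N t : -1 <= t <= 1 -> grid_round N t \in grid N.
Proof.
move=> /andP[t1 t2]; apply/mapP; exists (Num.truncn (N%:R * t + N%:R)) => //.
rewrite mem_iota add0n/= ltnS -(ler_nat R).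
have N0 : 0 <= N%:R :> R by [].
have /truncn_itv/andP[+ _] : 0 <= N%:R * t + N%:R by nra.
move=> /le_trans; apply; rewrite natrM; nra.
Qed.

Lemma grid_round_le N t : (0 < N)%N -> -1 <= t <= 1 ->
  (t - grid_round N t) ^+ 2 <= (N%:R^-1) ^+ 2.
Proof.
move=> N_gt0 /andP[t1 t2]; have N0 : 0 < N%:R :> R by rewrite ltr0n.
have /truncn_itv/andP[h1 h2] : 0 <= N%:R * t + N%:R by nra.
rewrite /grid_round; move: h1 h2; set m := Num.truncn _ => h1 h2.
have -> : t - (m%:R - N%:R) / N%:R = (N%:R * t + N%:R - m%:R) / N%:R.
  by field; rewrite gt_eqF.
rewrite exprMn ler_piMl ?sqr_ge0// expr_le1// ?subr_ge0//.
by rewrite lerBlDl natr1 ltW.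
Qed.

(** The zero step accommodates vectors with fewer nonzero coordinates than there are summands. *)
Definition net_steps N : seq 'rV[R]_p :=
  0 :: [seq c *: delta_mx 0 j | c <- grid N, j <- enum 'I_p].

(** An [s]-fold sumset: the support is not fixed in advance, so a single list serves all supports of
    size at most [s], and its length is a plain power. *)
Fixpoint sparse_net N s : seq 'rV[R]_p :=
  if s is s'.+1 then [seq a + b | a <- sparse_net N s', b <- net_steps N]
  else [:: 0].

Lemma size_sparse_net N s : size (sparse_net N s) = (((2 * N).+1 * p).+1 ^ s)%N.
Proof.
have sN : size (net_steps N) = ((2 * N).+1 * p).+1.
  by rewrite -[LHS]/((size _).+1) size_allpairs size_map size_iota size_enum_ord.
elim: s => // s IHs; rewrite expnSr -IHs -sN.
exact: (size_allpairs (fun a b => a + b)).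
Qed.

Definition round_on N J a : 'rV[R]_p := \sum_(j in J) grid_round N (a 0 j) *: delta_mx 0 j.

Lemma round_onE N J a j : round_on N J a 0 j = if j \in J then grid_round N (a 0 j) else 0.
Proof.
rewrite summxE; case: ifP => jJ.
  rewrite (bigD1 j)//= !mxE !eqxx mulr1 big1 ?addr0// => i /andP[_ ij].
  by rewrite !mxE eqxx eq_sym (negbTE ij) mulr0.
rewrite big1// => i iJ; rewrite !mxE eqxx/=; case: eqP => [ji|]; rewrite ?mulr0//.
by move: jJ; rewrite ji iJ.
Qed.

Lemma round_on_net N s J a : (#|J| <= s)%N -> (forall j, -1 <= a 0 j <= 1) ->
  round_on N J a \in sparse_net N s.
Proof.
move=> + a1; elim: s J => [|s IHs] J Js.
  have -> : J = finset.set0 by apply/eqP; rewrite -cards_eq0 -leqn0.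
  by rewrite /round_on big1 ?inE// => j; rewrite inE.
have [->|[j jJ]] := set_0Vmem J.
  apply/allpairsP; exists (round_on N finset.set0 a, 0); split => //=.
  - by apply: IHs; rewrite cards0.
  - by rewrite inE eqxx.
  - by rewrite addr0.
apply/allpairsP; exists (round_on N (J :\ j) a, grid_round N (a 0 j) *: delta_mx 0 j); split => /=.
- by apply: IHs; move: Js; rewrite (cardsD1 j) jJ.
- rewrite inE; apply/orP; right; apply/allpairsP.
  exists (grid_round N (a 0 j), j); split => //=; first exact: grid_round_mem.
  by rewrite mem_enum.
- by rewrite /round_on (big_setD1 j)//= addrC.
Qed.

Lemma sqnorm_round_on N s J a : (0 < N)%N -> (#|J| <= s)%N -> supported_on J a ->
  (forall j, -1 <= a 0 j <= 1) ->
  sqnorm (a - round_on N J a) <= s%:R * N%:R^-1 ^+ 2.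
Proof.
move=> N0 Js aJ a1.
apply: (@le_trans _ _ (\sum_(j in J) N%:R^-1 ^+ 2)); last first.
  rewrite sumr_const -[leLHS]mulr_natl ler_wpM2r ?sqr_ge0// ler_nat//.
rewrite /sqnorm [leRHS]big_mkcond/=; apply: ler_sum => j _.
rewrite mxE [X in _ + X]mxE round_onE; case: ifPn => jJ; first exact: grid_round_le.
by rewrite aJ// subr0 expr0n.
Qed.

Lemma sqnorm_lin2 (s t : R) a b :
  sqnorm (s *: a + t *: b) =
  s ^+ 2 * sqnorm a + 2 * (s * t) * dotp a b + t ^+ 2 * sqnorm b.
Proof. by rewrite -!dotpp -!bform1 bform_lin2// trmx1. Qed.

Lemma sqnormZ (t : R) a : sqnorm (t *: a) = t ^+ 2 * sqnorm a.
Proof. by rewrite -!dotpp -!bform1 bformZl bformZr mulrA expr2. Qed.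

Lemma supported_on_lin2 J (s t : R) a b : supported_on J a -> supported_on J b ->
  supported_on J (s *: a + t *: b).
Proof. by move=> aJ bJ j jJ; rewrite !mxE aJ// bJ// !mulr0 addr0. Qed.

Lemma sqr_le_sqnorm a j : a 0 j ^+ 2 <= sqnorm a.
Proof.
by rewrite /sqnorm (bigD1 j)//= lerDl; apply: sumr_ge0 => i _; exact: sqr_ge0.
Qed.

Lemma bounded_coord a j : sqnorm a <= 1 -> -1 <= a 0 j <= 1.
Proof.
move=> a1; rewrite -ler_norml -sqrtr_sqr -sqrtr1 ler_sqrt//.
exact: le_trans (sqr_le_sqnorm a j) a1.
Qed.

(** Polarisation at a + b and a - b, combined with the parallelogram law. Rescaling the two vectors
    inversely leaves the left side unchanged and can balance the right side. *)
Lemma bform_bilinear_bound (M : 'M[R]_p) (m : R) J a b : M^T = M ->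
  (forall u, supported_on J u -> `|bform M u u| <= m * sqnorm u) ->
  supported_on J a -> supported_on J b ->
  2 * `|bform M a b| <= m * (sqnorm a + sqnorm b).
Proof.
move=> sM hm aJ bJ.
have := hm (1 *: a + 1 *: b) (supported_on_lin2 _ _ aJ bJ).
have := hm (1 *: a + (-1) *: b) (supported_on_lin2 _ _ aJ bJ).
rewrite !bform_lin2// !sqnorm_lin2 !ler_norml => /andP[h1 h2] /andP[h3 h4].
have : `|bform M a b| <= m * (sqnorm a + sqnorm b) / 2.
  by rewrite ler_norml; apply/andP; split; lra.
lra.
Qed.

(** Let m be the supremum of the form over the unit ball of vectors supported on [J]. Replacing a
    vector by its rounding costs a fraction of m: m <= (25/16) D + (9/16) m, so m <= (25/7) D. *)
Lemma sparse_net_bound (M : 'M[R]_p) (D : R) s : (0 < s)%N -> M^T = M -> 0 <= D ->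
  (forall b, b \in sparse_net (4 * s) s -> `|bform M b b| <= D * sqnorm b) ->
  forall J, (#|J| <= s)%N ->
  forall a, supported_on J a -> `|bform M a a| <= 4 * D * sqnorm a.
Proof.
move=> s0 sM D0 hnet J Js.
pose B := [set r | exists2 a, supported_on J a /\ sqnorm a <= 1 & r = `|bform M a a|].
have B0 : B !=set0.
  exists 0; exists 0; last by rewrite bform0l normr0.
  split; first by move=> j _; rewrite mxE.
  by rewrite -[X in sqnorm X](scale0r 0) sqnormZ expr0n/= mul0r.
(* Finiteness of the supremum is what allows m to be absorbed into the left side later. *)
have Bub : has_ubound B.
  exists (\sum_i \sum_j `|M i j|) => _ [a [_ a1] ->].
  rewrite bformE (le_trans (ler_norm_sum _ _ _))//; apply: ler_sum => i _.
  rewrite (le_trans (ler_norm_sum _ _ _))//; apply: ler_sum => j _.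
  have /[!ler_norml] := bounded_coord i a1.
  have := bounded_coord i a1; have := bounded_coord j a1.
  rewrite -!ler_norml => hj hi _; rewrite !normrM.
  rewrite -[leRHS]mulr1 -[leRHS]mul1r mulrA; apply: ler_pM => //.
  by apply: ler_pM.
pose m := sup B.
have m0 : 0 <= m.
  case: B0 => r Br; apply: le_trans (ub_le_sup Bub Br).
  by case: Br => a _ ->.
have hm a : supported_on J a -> `|bform M a a| <= m * sqnorm a.
  move=> aJ; have [->|a0] := eqVneq a 0.
    by rewrite bform0l normr0 mulr_ge0// sqnorm_ge0.
  have n0 : 0 < sqnorm a by rewrite lt0r sqnorm_eq0 a0 sqnorm_ge0.
  pose r := (Num.sqrt (sqnorm a))^-1.
  have r2 : r ^+ 2 = (sqnorm a)^-1 by rewrite exprVn sqr_sqrtr// sqnorm_ge0.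
  have : B `|bform M (r *: a) (r *: a)|.
    exists (r *: a) => //; split.
      by move=> j jJ; rewrite mxE aJ// mulr0.
    by rewrite sqnormZ r2 mulVf// gt_eqF.
  move=> /(ub_le_sup Bub); rewrite bformZl bformZr mulrA -expr2 r2 normrM.
  by rewrite ger0_norm ?invr_ge0 ?sqnorm_ge0// ler_pdivrMl// mulrC.
have key : m <= 25 / 16 * D + 9 / 16 * m.
  apply: ge_sup => // _ [a [aJ a1] ->].
  pose a' := round_on (4 * s) J a.
  have a'J : supported_on J a'.
    by move=> j jJ; rewrite round_onE (negbTE jJ).
  have a1' j := bounded_coord j a1.
  pose x := a - a'.
  (* The mesh 1 / (4 s) gives at most s / (4 s)^2 = 1 / (16 s). *)
  have x1 : sqnorm x <= 16^-1.
    apply: (le_trans (sqnorm_round_on _ Js aJ a1')); first by rewrite muln_gt0.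
    have s1 : 1 <= s%:R :> R by rewrite ler1n.
    rewrite natrM exprVn -ler_pdivlMr ?invr_gt0 ?exprn_gt0 ?mulr_gt0 ?ltr0n//.
    rewrite invrK; nra.
  have xJ : supported_on J x by move=> j jJ; rewrite !mxE aJ// a'J// subr0.
  have /(_ a'J) := hm a'.
  have a'E : a' = 1 *: a + (-1) *: x.
    by rewrite scale1r scaleN1r opprB addrCA subrr addr0.
  (* This bounds -2 <a, x> by |a|^2 / 4 + 4 |x|^2, a sharp Young inequality at |a| = 1, |x| = 1/4.
     It yields |a'| <= 5/4 and |2 a - x| <= 9/4 in squared form. *)
  have xa0 := sqnorm_ge0 (1 *: a + 4 *: x); rewrite sqnorm_lin2 in xa0.
  have a'1 : sqnorm a' <= 25 / 16 by rewrite a'E sqnorm_lin2; lra.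
  have Da' : `|bform M a' a'| <= D * (25 / 16).
    apply: (le_trans (hnet _ (round_on_net _ Js a1'))).
    by rewrite ler_wpM2l.
  clearbody x.
  have aE : bform M a a = bform M a' a' + bform M x (2 *: a + (-1) *: x).
    rewrite a'E bform_lin2// bformDr !bformZr (bformC x a sM); ring.
  pose y := 2 *: a + (-1) *: x.
  have y1 : sqnorm y <= 81 / 16 by rewrite sqnorm_lin2; lra.
  have yJ : supported_on J y by exact: supported_on_lin2.
  (* The weights 3 and 1/3 balance the bounds on [x] and [y]. *)
  have := @bform_bilinear_bound M m J (3 *: x) (3^-1 *: y) sM hm.
  rewrite bformZl bformZr mulrA divff// mul1r !sqnormZ => hb.
  have {}hb : 2 * `|bform M x y| <= m * (9 / 8).
    apply: (le_trans (hb _ _)).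
    - by move=> j jJ; rewrite mxE xJ// mulr0.
    - by move=> j jJ; rewrite mxE yJ// mulr0.
    - by rewrite ler_wpM2l//; lra.
  move=> _; rewrite aE (le_trans (ler_normD _ _))//; lra.
have m4 : m <= 4 * D by lra.
move=> a aJ; apply: (le_trans (hm a aJ)).
by rewrite ler_wpM2r// sqnorm_ge0.
Qed.

End SparseNet.

(** * Overlap with the spike *)

Section Overlap.
Context {R : realType}.
Variables (p k : nat) (beta : R) (v : 'cV[R]_p).
Hypothesis beta_gt0 : 0 < beta.
Hypothesis spike : uniform_biased_spike k v.

(* The inverse square root of [spiked_cov beta v] when [v] is a unit vector. *)
Definition whitening : 'M[R]_p :=
  1%:M + ((Num.sqrt (1 + beta))^-1 - 1) *: (v *m v^T).

Let s : R := (Num.sqrt (1 + beta))^-1.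

Let s2 : s ^+ 2 * (1 + beta) = 1.
Proof.
have b1 : 0 < 1 + beta by rewrite addr_gt0.
by rewrite exprVn sqr_sqrtr ?ltW// mulVf// gt_eqF.
Qed.

Lemma whitening_sym : whitening^T = whitening.
Proof. by rewrite /whitening linearD/= linearZ/= trmx_mul trmxK trmx1. Qed.

Lemma sqnorm_spike : sqnorm v^T = 1.
Proof. by case: spike => + _ _ => <-; apply: eq_bigr => j _; rewrite mxE. Qed.

Lemma mulmx_whitening a : a *m whitening = a + ((s - 1) * dotp a v^T) *: v^T.
Proof.
rewrite /whitening mulmxDr mulmx1 -scalemxAr; congr (_ + _).
rewrite mulmxA -scalerA; congr (_ *: _); apply/rowP => j.
rewrite [LHS]mxE big_ord1 [RHS]mxE; congr (_ * _).
by rewrite mxE; apply: eq_bigr => i _; rewrite mxE.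
Qed.

Lemma bform_spiked_cov_whitening a :
  bform (spiked_cov beta v) (a *m whitening) (a *m whitening) = sqnorm a.
Proof.
rewrite mulmx_whitening; set t := dotp a v^T.
have -> : a + ((s - 1) * t) *: v^T = 1 *: a + ((s - 1) * t) *: v^T by rewrite scale1r.
rewrite bform_lin2; last exact: spiked_cov_sym.
rewrite !bform_spiked_cov !dotpp sqnorm_spike -/t.
transitivity (sqnorm a + t ^+ 2 * (s ^+ 2 * (1 + beta) - 1)); first ring.
by rewrite s2 subrr mulr0 addr0.
Qed.

(** Only the restriction of [v] to [I] meets [w]. Its squared norm is the recovered proportion of
    the support, and Cauchy-Schwarz concludes. *)
Lemma sqr_dotp_spike (I : {set 'I_p}) (w : 'rV[R]_p) :
  supported_on I w -> sqnorm w = 1 ->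
  dotp w v^T ^+ 2 * k%:R <= #|I :&: support_of v|%:R.
Proof.
move=> wI w1; case: spike => v1 vk vE.
have k0 : (0 < k)%N.
  rewrite -vk lt0n; apply/eqP => /eqP; rewrite cards_eq0 => /eqP v0.
  have : \sum_(j < p) v j 0 ^+ 2 = 0.
    apply: big1 => j _; have : j \notin support_of v by rewrite v0 inE.
    by rewrite inE negbK => /eqP ->; rewrite expr0n.
  by rewrite v1 => /eqP; rewrite oner_eq0.
have kR : 0 < k%:R :> R by rewrite ltr0n.
pose vI : 'rV[R]_p := \row_j if j \in I then v j 0 else 0.
have -> : dotp w v^T = dotp w vI.
  apply: eq_bigr => j _; rewrite !mxE; case: ifPn => // jI.
  by rewrite wI// !mul0r.
rewrite -ler_pdivlMr//; apply: (le_trans (dotp_cauchy_schwarz _ _)).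
rewrite w1 mul1r /sqnorm -sumr_const.
rewrite mulr_suml [leRHS]big_mkcond/=; apply: ler_sum => j _.
rewrite mxE !inE; case: (boolP (j \in I)) => jI /=; last by rewrite expr0n.
case: ifP => [vj|/negbFE/eqP ->]; last by rewrite expr0n.
by rewrite vE ?inE// exprVn sqr_sqrtr// mul1r.
Qed.

(** Write w = t v + y with y orthogonal to v, and h = |y|. The comparison Q(w) >= Q(v) leaves beta
    h^2 / 2 <= 2 |Q(v, y)|, and the cross term is at most 8 sqrt((1 + beta) L) h. Dividing by h
    bounds h itself. *)
Lemma overlap_bound (Sigma : 'M[R]_p) (delta0 L : R) (I : {set 'I_p}) (w : 'rV[R]_p) :
  Sigma^T = Sigma -> (forall u, 0 <= bform Sigma u u) ->
  0 <= delta0 <= 1 -> 0 <= L ->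
  delta0 * (1 + beta) + 4 * (L + Num.sqrt L) <= beta / 2 ->
  concentrated_at beta v delta0 v^T Sigma ->
  (forall J : {set 'I_p}, (#|J| <= 2 * k)%N -> forall a, supported_on J a ->
    `|bform (whitening *m (Sigma - spiked_cov beta v) *m whitening^T) a a|
      <= 4 * (L + Num.sqrt L) * sqnorm a) ->
  #|I| = k -> supported_on I w -> sqnorm w = 1 ->
  bform Sigma v^T v^T <= bform Sigma w w ->
  (1 - 32 * (Num.sqrt ((1 + beta) * L) / beta)) * k%:R <= #|I :&: support_of v|%:R.
Proof.
move=> sS pS /andP[d0 d01] L0 small cv unif Ik wI w1 le_vw.
set d1 := 4 * _ in small unif.
have rL0 := sqrtr_ge0 L.
have rL2 : Num.sqrt L ^+ 2 = L by rewrite sqr_sqrtr.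
have d10 : 0 <= d1 by rewrite /d1; lra.
apply: le_trans (sqr_dotp_spike wI w1).
rewrite ler_wpM2r//.
pose t := dotp w v^T.
have v1 := sqnorm_spike.
have wt : dotp w v^T = t by [].
have sv : supported_on (support_of v) v^T.
  by move=> j; rewrite inE negbK mxE => /eqP.
pose y := w - t *: v^T.
pose J := I :|: support_of v.
have Jk : (#|J| <= 2 * k)%N.
  by case: spike => _ vk _; rewrite (leq_trans (leq_card_setU _ _))// Ik vk mul2n addnn.
have vJ : supported_on J v^T by move=> j; rewrite inE negb_or => /andP[_]; exact: sv.
have yJ : supported_on J y.
  move=> j; rewrite inE negb_or => /andP[jI jv].
  by rewrite mxE wI// add0r mxE mxE sv// mulr0 oppr0.
have yE : y = 1 *: w + (- t) *: v^T by rewrite scale1r scaleNr.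
have ynorm : sqnorm y = 1 - t ^+ 2.
  by rewrite yE sqnorm_lin2 w1 v1 wt; ring.
have yv : dotp y v^T = 0.
  by rewrite yE -bform1 bformDl !bformZl !bform1 wt dotpp v1; ring.
have wE : w = t *: v^T + 1 *: y by rewrite scale1r addrCA subrr addr0.
clearbody y.
pose h := Num.sqrt (sqnorm y).
have h0 : 0 <= h by exact: sqrtr_ge0.
have h2 : h ^+ 2 = sqnorm y by rewrite sqr_sqrtr// sqnorm_ge0.
have h1 : h <= 1.
  by rewrite -(ler_pXn2r (n := 2))// ?nnegrE// h2 ynorm expr1n gerBl sqr_ge0.
pose M := whitening *m (Sigma - spiked_cov beta v) *m whitening^T.
have sM : M^T = M.
  rewrite /M !trmx_mul trmxK mulmxA; congr (_ *m _ *m _).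
  by rewrite linearB/= sS spiked_cov_sym.
(* As [y] is orthogonal to [v], whitening fixes [y] and scales [v] by [s], and the population cross
   term of the two vanishes. *)
have yW : y *m whitening = y by rewrite mulmx_whitening yv mulr0 scale0r addr0.
have vW : v^T *m whitening = s *: v^T.
  by rewrite mulmx_whitening dotpp v1 mulr1 -{1}(scale1r v^T) -scalerDl addrC subrK.
have Gvy : bform (spiked_cov beta v) v^T y = 0.
  rewrite bform_spiked_cov yv mulr0 mulr0 add0r.
  by rewrite -bform1 bformC ?trmx1// bform1.
have Gy : bform (spiked_cov beta v) y y = sqnorm y.
  by rewrite bform_spiked_cov yv !mulr0 add0r dotpp.
have Gv : bform (spiked_cov beta v) v^T v^T = 1 + beta.
  by rewrite bform_spiked_cov !dotpp v1; ring.
have Qy : bform Sigma y y <= (1 + d1) * h ^+ 2.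
  have := unif J Jk y yJ; rewrite bform_conj yW bformB Gy h2 ler_norml => /andP[_]; lra.
have Qv : (1 - delta0) * (1 + beta) <= bform Sigma v^T v^T <= 2 * (1 + beta).
  move: cv; rewrite /concentrated_at Gv ler_norml => /andP[c1 c2].
  by apply/andP; split; nra.
pose X := bform Sigma v^T y.
have s0 : 0 < s by rewrite invr_gt0 sqrtr_gt0; lra.
have X1 : s * `|X| * h <= d1 * h ^+ 2.
  (* The factor [h] gives both arguments the same norm. *)
  have := bform_bilinear_bound sM (unif J Jk) (a := h *: v^T) (b := y).
  rewrite bform_conj yW -scalemxAl vW bformB scalerA !bformZl Gvy mulr0 subr0 -/X.
  rewrite sqnormZ v1 mulr1 -h2 !normrM (ger0_norm h0) (ger0_norm (ltW s0)).
  move=> /(_ _ yJ) H.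
  have : 2 * (h * s * `|X|) <= d1 * (h ^+ 2 + h ^+ 2).
    by apply: H => j jJ; rewrite mxE vJ// mulr0.
  lra.
have X2 : X ^+ 2 <= 2 * (1 + beta) * ((1 + d1) * h ^+ 2).
  apply: (le_trans (bform_cauchy_schwarz v^T y sS pS)); rewrite -/X.
  have /andP[_ q2] := Qv.
  by apply: ler_pM => //; exact: pS.
(* For [L <= 1] the bilinear bound is the better one; for [L >= 1] it is
   Cauchy-Schwarz, which only loses the square root of [1 + d1 = O(L)]. *)
have X3 : s * `|X| <= 8 * Num.sqrt L * h.
  have [h_eq0|hn0] := eqVneq h 0.
    move: X2; rewrite h_eq0 expr0n/= !mulr0 => X2.
    have /eqP : X ^+ 2 = 0 by apply/eqP; rewrite eq_le X2 sqr_ge0.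
    by rewrite sqrf_eq0 => /eqP ->; rewrite normr0 mulr0.
  have hp : 0 < h by rewrite lt0r hn0.
  have [L1|L1] := leP L 1.
    have rL1 : Num.sqrt L <= 1 by rewrite -sqrtr1 ler_sqrt.
    apply: (@le_trans _ _ (d1 * h)); last first.
      rewrite ler_wpM2r// /d1 -[X in X + _]rL2; nra.
    by rewrite -(ler_pM2r hp) -[leRHS]mulrA -expr2.
  have rL1 : 1 <= Num.sqrt L by rewrite -sqrtr1 ler_sqrt// ltW.
  rewrite -(ler_pXn2r (n := 2))// ?nnegrE ?mulr_ge0//; last exact: ltW.
  rewrite !exprMn rL2 real_normK ?num_real//.
  apply: (@le_trans _ _ (s ^+ 2 * (2 * (1 + beta) * ((1 + d1) * h ^+ 2)))).
    by rewrite ler_wpM2l ?sqr_ge0.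
  rewrite (_ : _ * _ = s ^+ 2 * (1 + beta) * (2 * (1 + d1) * h ^+ 2)); last ring.
  rewrite s2 mul1r ler_wpM2r ?sqr_ge0// /d1.
  have : Num.sqrt L <= L by rewrite -[leRHS]rL2 expr2 ler_peMl.
  lra.
have t1 : `|t| <= 1.
  rewrite -(ler_pXn2r (n := 2))// ?nnegrE// real_normK ?num_real// expr1n.
  by have := sqr_ge0 h; rewrite h2 ynorm subr_ge0.
have tX : 2 * t * X <= 2 * `|X|.
  rewrite -mulrA ler_pM2l// (le_trans (ler_norm _))// normrM.
  by rewrite ler_piMl.
(* Expanding Q(t v + y) gives (1 - t^2) Q(v) <= 2 t X + Q(y), with 1 - t^2 = h^2. The gap between
   the lower bound on Q(v) and the factor 1 + d1 in the bound on Q(y) is at least beta / 2 by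
   [small]. *)
have main : h ^+ 2 * (beta / 2) <= 2 * `|X|.
  have := le_vw; rewrite [X in _ <= bform Sigma X _]wE [X in _ <= bform Sigma _ X]wE.
  rewrite bform_lin2// -/X => le_vw'.
  have /andP[q1 _] := Qv.
  have : h ^+ 2 * bform Sigma v^T v^T <= 2 * `|X| + (1 + d1) * h ^+ 2.
    rewrite h2 in Qy *; rewrite ynorm in Qy *; lra.
  have h2p := sqr_ge0 h.
  have : h ^+ 2 * ((1 - delta0) * (1 + beta)) <= h ^+ 2 * bform Sigma v^T v^T.
    by rewrite ler_wpM2l.
  have : h ^+ 2 * (delta0 * (1 + beta) + d1) <= h ^+ 2 * (beta / 2).
    by rewrite ler_wpM2l.
  lra.
have {}main : h * (s * beta) <= 32 * Num.sqrt L.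
  have [h_eq0|hn0] := eqVneq h 0; first by rewrite h_eq0 mul0r mulr_ge0.
  have hp : 0 < h by rewrite lt0r hn0.
  rewrite -(ler_pM2r hp).
  have : s * (h ^+ 2 * (beta / 2)) <= s * (2 * `|X|) by rewrite ler_pM2l.
  lra.
have -> : Num.sqrt ((1 + beta) * L) = Num.sqrt L / s.
  by rewrite sqrtrM ?addr_ge0 ?ltW// /s invrK mulrC.
have hle : h <= 32 * (Num.sqrt L / s / beta).
  by rewrite !mulrA ler_pdivlMr// ler_pdivlMr// -mulrA [beta * s]mulrC.
(* Since h <= 1, the bound on h is also one on h^2 = 1 - t^2. *)
have hh : h ^+ 2 <= h by rewrite expr2 ler_piMl.
rewrite h2 ynorm in hh; rewrite -/t; lra.
Qed.

End Overlap.

(** * The greedy step *)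

Section Greedy.
Context {R : realType}.
Variable p : nat.
Implicit Types (f : {set 'I_p} -> R) (I S seed : {set 'I_p}).

Lemma take_perm_setC seed (s : seq 'I_p) r : perm_eq s (enum (~: seed)%SET) ->
  (r <= p - #|seed|)%N ->
  #|[set i in take r s]%SET| = r /\
  (seed :&: [set i in take r s] = finset.set0)%SET.
Proof.
move=> ps rp.
have us : uniq s by rewrite (perm_uniq ps) enum_uniq.
have ss : size s = (p - #|seed|)%N.
  by have := cardsC seed; rewrite (perm_size ps) -cardE card_ord => /(canRL (addKn _)).
split.
  by rewrite cardsE (card_uniqP _) ?take_uniq// size_takel// ss.
apply/setP => i; rewrite !inE; apply/negP => /andP[iS /mem_take].
by rewrite (perm_mem ps) mem_enum inE iS.
Qed.

Lemma GreedySPCA_card f seed k S : (#|seed| <= k)%N -> (k <= p)%N ->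
  GreedySPCA f seed k S -> #|S| = k.
Proof.
move=> sk kp [s [ps _ ->]].
have [ck dis] := take_perm_setC ps (leq_sub2r #|seed| kp).
by rewrite cardsU dis cards0 subn0 ck subnKC.
Qed.

(** The strict inequality places every candidate of [I] before every candidate outside of [I],
    however ties are broken, and exactly as many candidates are taken as [I] still lacks. *)
Lemma GreedySPCA_separated f seed I S : seed \subset I ->
  (forall i j, i \in I :\: seed -> j \notin I ->
    f (j |: seed)%SET < f (i |: seed)%SET) ->
  GreedySPCA f seed #|I| S -> S = I.
Proof.
move=> sI sep [s [ps so ->]].
have Ip : (#|I| - #|seed| <= p - #|seed|)%N.
  by rewrite leq_sub2r// -[leqRHS]card_ord max_card.
have [ck dis] := take_perm_setC ps Ip.
set r := (#|I| - #|seed|)%N in ck dis *.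
have cD : #|I :\: seed| = r by rewrite cardsD (finset.setIidPr sI).
suff -> : [set i in take r s]%SET = I :\: seed.
  by rewrite finset.setDE finset.setUIr finset.setUCr finset.setIT; exact/finset.setUidPr.
(* If some [y] of [I :\: seed] is not taken, no taken element can lie outside of [I], as it would
   precede [y]. In both cases an inclusion and equal cardinalities give equality. *)
have [sub|/fintype.subsetPn[y yI yt]] := boolP (I :\: seed \subset [set i in take r s]%SET).
  by apply/esym/eqP; rewrite eqEcard sub ck cD leqnn.
have : [set i in take r s]%SET \subset I :\: seed.
  apply/fintype.subsetP => x xt; rewrite inE; apply/andP; split.
    apply/negP => xs; have : x \in (seed :&: [set i in take r s])%SET.
      by rewrite inE xs xt.
    by rewrite dis inE.
  apply: contraT => xI.
  have yd : y \in drop r s.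
    have : y \in s by rewrite (perm_mem ps) mem_enum inE; move: yI; rewrite inE => /andP[].
    by rewrite -{1}(cat_take_drop r s) mem_cat; move: yt; rewrite inE => /negbTE ->.
  have tr : transitive (fun i j : 'I_p => f (j |: seed)%SET <= f (i |: seed)%SET).
    by move=> a b c h1 h2; exact: le_trans h2 h1.
  move: so; rewrite sorted_pairwise// -{1}(cat_take_drop r s) pairwise_cat.
  move=> /andP[/allrelP/(_ x y) + _]; rewrite inE in xt => /(_ xt yd).
  by rewrite leNgt sep.
move=> sub; apply/eqP; rewrite eqEcard sub ck cD leqnn//.
Qed.

(** One good seed suffices: its output [I] competes in the final maximisation. *)
Lemma SSPCA_separated f1 f2 k kstar (I I' seed : {set 'I_p}) :
  #|I| = k -> (kstar <= k)%N -> #|seed| = kstar -> seed \subset I ->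
  (forall i j, i \in I :\: seed -> j \notin I ->
    f1 (j |: seed)%SET < f1 (i |: seed)%SET) ->
  SSPCA f1 f2 k kstar I' -> #|I'| = k /\ f2 I <= f2 I'.
Proof.
move=> Ik kk sk sI sep [out [hout [best bk [-> hbest]]]]; split.
  apply: (GreedySPCA_card _ _ (hout _ bk)); first by rewrite bk.
  by rewrite -Ik -[leqRHS]card_ord max_card.
have <- : out seed = I.
  by apply: GreedySPCA_separated sI sep _; rewrite Ik; exact: hout.
exact: hbest.
Qed.

Definition set_row S : 'rV[R]_p := \row_j (j \in S)%:R.

Lemma f_avgE (A : 'M[R]_p) S : f_avg A S = #|S|%:R^-1 * bform A (set_row S) (set_row S).
Proof.
rewrite /f_avg bformE; congr (_ * _); rewrite big_mkcond/=; apply: eq_bigr => i _.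
rewrite big_mkcond/=; case: ifPn => iS.
  by apply: eq_bigr => j _; rewrite !mxE iS mul1r; case: ifP; rewrite ?mulr1 ?mulr0.
by rewrite big1// => j _; rewrite !mxE (negbTE iS) !mul0r.
Qed.

Lemma set_rowU1 i S : i \notin S -> set_row (i |: S) = set_row S + set_row [set i]%SET.
Proof.
move=> iS; apply/rowP => j; rewrite !mxE !inE.
by case: eqP => [->|] /=; rewrite ?(negbTE iS) ?add0r ?addr0.
Qed.

Lemma dotp_set_row S S' : dotp (set_row S) (set_row S') = #|S :&: S'|%:R.
Proof.
rewrite -sumr_const [RHS]big_mkcond/=; apply: eq_bigr => j _.
by rewrite !mxE inE -natrM mulnb; case: (_ && _).
Qed.

Definition swap_row (i j : 'I_p) : 'rV[R]_p := set_row [set i]%SET - set_row [set j]%SET.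

Definition sum_row (i j : 'I_p) S : 'rV[R]_p :=
  2 *: set_row S + (set_row [set i]%SET + set_row [set j]%SET).

(* Polarisation of f_avg(S + i) - f_avg(S + j). *)
Lemma f_avg_lt (A : 'M[R]_p) S i j : A^T = A -> i \notin S -> j \notin S ->
  0 < bform A (swap_row i j) (sum_row i j S) ->
  f_avg A (j |: S)%SET < f_avg A (i |: S)%SET.
Proof.
move=> sA iS jS; rewrite !f_avgE !cardsU1 iS jS !set_rowU1//.
set e := set_row [set i]%SET; set e' := set_row [set j]%SET; set s := set_row S => h.
rewrite ltr_pM2l ?invr_gt0 ?ltr0n// -subr_gt0.
move: h; rewrite /swap_row /sum_row -/e -/e' -/s -[- e']scaleN1r.
rewrite !(bformDl, bformDr, bformZl, bformZr).
rewrite (bformC e s sA) (bformC e' s sA) (bformC e' e sA); lra.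
Qed.

Section Separation.
Variables (k : nat) (beta : R) (v : 'cV[R]_p).
Hypothesis beta_ge0 : 0 <= beta.
Hypothesis spike : uniform_biased_spike k v.

Local Notation G := (spiked_cov beta v).

(* The normalisation makes the two vectors [sep_row 1] and [sep_row (-1)]
   detect the bilinear form at scale [sqrt (q a * q b)]. *)
Definition sep_row (t : R) i j S : 'rV[R]_p :=
  Num.sqrt (bform G (sum_row i j S) (sum_row i j S)) *: swap_row i j +
  (t * Num.sqrt (bform G (swap_row i j) (swap_row i j))) *: sum_row i j S.

Lemma dotp_set_row_spike S : S \subset support_of v ->
  dotp (set_row S) v^T = #|S|%:R / Num.sqrt k%:R.
Proof.
case: spike => _ _ vE sub; rewrite -sumr_const mulr_suml [RHS]big_mkcond/=.
apply: eq_bigr => j _; rewrite !mxE; case: ifPn => jS; last by rewrite mul0r.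
by rewrite vE// (fintype.subsetP sub).
Qed.

(** The values of Q at the two separating rows differ by 4 rx ry Q(x, y), and their means sum to 4
    (rx ry)^2. Hence Q(x, y) >= b m - delta rx ry, where q(x) = rx^2 = 2 + b, q(y) = ry^2 = 2 m + b
    m^2 and q(x, y) = b m. *)
Lemma concentrated_separation (A : 'M[R]_p) (delta : R) S i j :
  A^T = A -> 0 <= delta -> S \subset support_of v ->
  i \in support_of v :\: S -> j \notin support_of v ->
  concentrated_at beta v delta (sep_row 1 i j S) A ->
  concentrated_at beta v delta (sep_row (-1) i j S) A ->
  let m : R := (2 * #|S| + 1)%:R in let b : R := beta / k%:R in
  delta ^+ 2 * ((2 + b) * (2 * m + b * m ^+ 2)) < (b * m) ^+ 2 ->
  0 < bform A (swap_row i j) (sum_row i j S).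
Proof.
move=> sA d0 Ssub; rewrite inE => /andP[iS iv] jv c1 c2 m b small.
have jS : j \notin S by apply: contra jv; exact: fintype.subsetP.
have ij : i != j by apply: contraNneq jv => <-.
have k0 : (0 < k)%N.
  by case: spike => _ <- _; rewrite (cardD1 i) iv.
have kR : 0 < k%:R :> R by rewrite ltr0n.
set x := swap_row i j in c1 c2 *; set y := sum_row i j S in c1 c2 *.
have mE : m = 2 * #|S|%:R + 1 by rewrite /m natrD natrM.
have m0 : 0 < m by rewrite ltr0n addn1.
have b0 : 0 <= b by rewrite divr_ge0.
pose rk : R := Num.sqrt k%:R.
have rk0 : 0 < rk by rewrite sqrtr_gt0.
have rk2 : k%:R = rk ^+ 2 by rewrite sqr_sqrtr.
have jv0 : dotp (set_row [set j]%SET) v^T = 0.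
  apply: big1 => l _; rewrite !mxE inE; case: eqP => [->|]; last by rewrite mul0r.
  by move: jv; rewrite inE negbK => /eqP ->; rewrite mulr0.
have iv1 : dotp (set_row [set i]%SET) v^T = rk^-1.
  have isub : [set i]%SET \subset support_of v by rewrite finset.sub1set.
  by rewrite dotp_set_row_spike// cards1 mul1r.
have Sv : dotp (set_row S) v^T = #|S|%:R / rk by rewrite dotp_set_row_spike.
have dD (a c d : 'rV[R]_p) : dotp (a + c) d = dotp a d + dotp c d.
  by rewrite -!bform1 bformDl.
have dZ (t : R) (a d : 'rV[R]_p) : dotp (t *: a) d = t * dotp a d.
  by rewrite -!bform1 bformZl.
have dC (a c : 'rV[R]_p) : dotp a c = dotp c a.
  by rewrite -!bform1 bformC// trmx1.
have xv : dotp x v^T = rk^-1.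
  by rewrite /x /swap_row -scaleN1r dD dZ iv1 jv0 mulr0 addr0.
have yv : dotp y v^T = m / rk.
  by rewrite /y /sum_row !dD dZ Sv iv1 jv0 mE; ring.
have dDr (a c d : 'rV[R]_p) : dotp d (a + c) = dotp d a + dotp d c.
  by rewrite !(dC d) dD.
have dZr (t : R) (a d : 'rV[R]_p) : dotp d (t *: a) = t * dotp d a.
  by rewrite !(dC d) dZ.
have d0r (S1 S2 : {set 'I_p}) : (S1 :&: S2 = finset.set0)%SET ->
    dotp (set_row S1) (set_row S2) = 0.
  by move=> SS; rewrite dotp_set_row SS cards0.
have cii : dotp (set_row [set i]%SET) (set_row [set i]%SET) = 1.
  by rewrite dotp_set_row finset.setIid cards1.
have cjj : dotp (set_row [set j]%SET) (set_row [set j]%SET) = 1.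
  by rewrite dotp_set_row finset.setIid cards1.
have cij : dotp (set_row [set i]%SET) (set_row [set j]%SET) = 0.
  apply: d0r; apply/setP => z; rewrite !inE.
  by case: eqP => // ->; rewrite (negbTE ij).
have ciS : dotp (set_row [set i]%SET) (set_row S) = 0.
  by apply: d0r; apply/setP => z; rewrite !inE; case: eqP => // ->; rewrite (negbTE iS).
have cjS : dotp (set_row [set j]%SET) (set_row S) = 0.
  by apply: d0r; apply/setP => z; rewrite !inE; case: eqP => // ->; rewrite (negbTE jS).
have cSS : dotp (set_row S) (set_row S) = #|S|%:R by rewrite dotp_set_row finset.setIid.
have cji := cij; rewrite dC in cji.
have cSi := ciS; rewrite dC in cSi.
have cSj := cjS; rewrite dC in cSj.
have xE : x = set_row [set i]%SET + (-1) *: set_row [set j]%SET by rewrite scaleN1r.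
have yE : y = 2 *: set_row S + (set_row [set i]%SET + set_row [set j]%SET) by [].
have gxx : bform G x x = 2 + b.
  rewrite bform_spiked_cov xv xE !(dD, dZ, dDr, dZr) cii cjj cij cji /b rk2.
  by field; rewrite gt_eqF.
have gxy : bform G x y = b * m.
  rewrite bform_spiked_cov xv yv xE yE !(dD, dZ, dDr, dZr) cii cjj cij cji ciS cjS /b rk2.
  by field; rewrite gt_eqF.
have gyy : bform G y y = 2 * m + b * m ^+ 2.
  rewrite bform_spiked_cov yv yE !(dD, dZ, dDr, dZr).
  rewrite cii cjj cij cji ciS cjS cSi cSj cSS /b rk2 mE.
  by field; rewrite gt_eqF.
have qx0 : 0 < bform G x x by rewrite gxx; lra.
have qy0 : 0 < bform G y y.
  by rewrite gyy ltr_wpDr// ?mulr_gt0// mulr_ge0// sqr_ge0.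
have sG := spiked_cov_sym beta v.
move: c1 c2; rewrite /concentrated_at /sep_row -/x -/y !bform_lin2//.
set rx := Num.sqrt (bform G x x); set ry := Num.sqrt (bform G y y).
have rx0 : 0 < rx by rewrite sqrtr_gt0.
have ry0 : 0 < ry by rewrite sqrtr_gt0.
have rx2 : bform G x x = rx ^+ 2 by rewrite sqr_sqrtr// ltW.
have ry2 : bform G y y = ry ^+ 2 by rewrite sqr_sqrtr// ltW.
rewrite -gxx -gyy -gxy rx2 ry2 in small.
rewrite rx2 ry2 gxy.
set X := bform A x y; set Ax := bform A x x; set Ay := bform A y y.
rewrite !ler_norml => /andP[h1 _] /andP[_ h2].
have r0 : 0 < rx * ry by rewrite mulr_gt0.
(* This is the square root of the hypothesis [small]. *)
have bm : delta * (rx * ry) < b * m.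
  rewrite -(ltr_pXn2r (n := 2))// ?nnegrE; last 2 first.
  - by rewrite mulr_ge0// ltW.
  - by rewrite mulr_ge0// ltW.
  by rewrite -gxy !exprMn.
rewrite -(pmulr_rgt0 _ r0).
have : 0 < rx * ry * (b * m - delta * (rx * ry)) by rewrite mulr_gt0// subr_gt0.
lra.
Qed.

End Separation.
End Greedy.

(** * Recovery with high probability *)

Section Recovery.
Context {R : realType} d (T : measurableType d) (P : probability T R).
Variables (n p k kstar : nat) (beta : R) (v : 'cV[R]_p).
Variable x : 'I_n -> {mfun T >-> p.-tuple R}.
Hypothesis model : UBSPCA P k beta v x.
Hypothesis n_gt0 : (0 < n)%N.

Let Sigma w := sample_covariance (data_matrix x w).

Definition all_concentrated (delta : R) (l : seq 'rV[R]_p) : set T :=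
  [set w | forall u, u \in l -> concentrated_at beta v delta u (Sigma w)].

Lemma all_concentrated_prob (eta delta : R) (l : seq 'rV[R]_p) :
  0 <= eta <= 1 -> eta <= delta ->
  measurable (all_concentrated delta l) /\
  (P (~` all_concentrated delta l) <=
   ((size l)%:R * (2 * expR (- (n%:R * (eta * delta) / 16))))%:E)%E.
Proof.
move=> eta01 ed; elim: l => [|u l [mA IHl]].
  have -> : all_concentrated delta [::] = setT by apply/seteqP; split.
  by rewrite setCT measure0 mul0r; split.
have [mU PU] := UBSPCA_concentration model u n_gt0 eta01 ed.
have -> : all_concentrated delta (u :: l) =
    [set w | concentrated_at beta v delta u (Sigma w)] `&` all_concentrated delta l.
  apply/seteqP; split => w /=.
    by move=> h; split => [|z zl]; apply: h; rewrite inE ?eqxx// zl orbT.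
  by move=> [h1 h2] z; rewrite inE => /predU1P[->|/h2].
split; first exact: measurableI.
rewrite setCI; apply: le_trans; first by apply: measureU2; exact: measurableC.
by rewrite /= -nat1r mulrDl mul1r EFinD leeD.
Qed.

Lemma exists_subset_card (I : {set 'I_p}) m : (m <= #|I|)%N ->
  exists2 S : {set 'I_p}, S \subset I & #|S| = m.
Proof.
move=> mI; exists [set i in take m (enum I)]%SET.
  by apply/fintype.subsetP => i; rewrite inE => /mem_take; rewrite mem_enum.
by rewrite cardsE (card_uniqP _) ?take_uniq ?enum_uniq// size_takel// -cardE.
Qed.

Lemma SSPCA_recovery (delta0 L : R) :
  0 < beta -> (kstar <= k)%N -> 0 <= delta0 <= 1 -> 0 <= L ->
  delta0 * (1 + beta) + 4 * (L + Num.sqrt L) <= beta / 2 ->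
  (let m : R := (2 * kstar + 1)%:R in let b : R := beta / k%:R in
   delta0 ^+ 2 * ((2 + b) * (2 * m + b * m ^+ 2)) < (b * m) ^+ 2) ->
  exists A : set T, [/\ measurable A,
    (P (~` A) <= ((2 * p ^ 2 + 1)%:R * (2 * expR (- (n%:R * delta0 ^+ 2 / 16))) +
       (((16 * k).+1 * p).+1 ^ (2 * k))%:R * (2 * expR (- (n%:R * L / 16))))%:E)%E &
    A `<=` [set w | forall I : {set 'I_p},
      SSPCA (f_avg (Sigma w)) (f_lambda1 (Sigma w)) k kstar I ->
      (1 - 32 * (Num.sqrt ((1 + beta) * L) / beta)) * k%:R <=
        #|I :&: support_of v|%:R]].
Proof.
move=> b0 kk /andP[d0 d01] L0 small sep.
have [_ spike _ _] := model.
have Ik : #|support_of v| = k by case: spike.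
(* The seed depends on [v] alone and not on the sample, so the union bound runs over pairs of
   indices and not over seeds. *)
have [seed sI sk] : exists2 S : {set 'I_p}, S \subset support_of v & #|S| = kstar.
  by apply: exists_subset_card; rewrite Ik.
have rL0 := sqrtr_ge0 L.
have rL2 : Num.sqrt L ^+ 2 = L by rewrite sqr_sqrtr.
pose delta := L + Num.sqrt L.
(* The product eta delta is at least L in both regimes: it is delta >= L when delta exceeds 1, and
   delta^2 >= L otherwise. *)
pose eta := Num.min 1 delta.
have delta_ge0 : 0 <= delta by rewrite addr_ge0.
have eta01 : 0 <= eta <= 1 by rewrite /eta le_min ler01 delta_ge0/= ge_min lexx.
have eta_delta : eta <= delta by rewrite /eta ge_min lexx orbT.
have L_le : L <= eta * delta.
  rewrite /eta minElt; case: ifP => _; first by rewrite mul1r /delta lerDl.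
  by rewrite -{1}rL2 /delta -expr2 lerXn2r ?nnegrE// lerDr.
pose seps t := [seq sep_row beta v t i j seed | i <- enum 'I_p, j <- enum 'I_p].
(* The spike itself is included for the lower bound on Q(v). *)
pose l1 := v^T :: (seps 1 ++ seps (-1)).
(* The net lives in whitened coordinates, where the relative error becomes an error proportional to
   the squared norm. The sparsity 2k accounts for the union of the output and the support. *)
pose l2 := [seq u *m whitening beta v | u <- sparse_net p (4 * (2 * k)) (2 * k)].
have sl1 : size l1 = (2 * p ^ 2 + 1)%N.
  rewrite /l1/= size_cat !size_allpairs !size_enum_ord.
  by rewrite mulnn addnn -mul2n addn1.
have sl2 : size l2 = (((16 * k).+1 * p).+1 ^ (2 * k))%N.
  by rewrite size_map size_sparse_net; rewrite !mulnA.
have d0' : 0 <= delta0 <= 1 by rewrite d0.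
have [mA1 PA1] := all_concentrated_prob l1 d0' (lexx delta0).
have [mA2 PA2] := all_concentrated_prob l2 eta01 eta_delta.
exists (all_concentrated delta0 l1 `&` all_concentrated delta l2); split.
- exact: measurableI.
- rewrite setCI; apply: le_trans; first by apply: measureU2; exact: measurableC.
  rewrite EFinD -sl1 -sl2 leeD//.
  apply: (le_trans PA2); rewrite lee_fin ler_wpM2l// ler_wpM2l// ler_expR lerN2.
  by rewrite ler_wpM2r// ler_wpM2l.
move=> w /= [c1 c2] I hI.
(* For [k = 0] the convention [0^-1 = 0] makes b zero, which contradicts the strict inequality
   [sep]. *)
have k_gt0 : (0 < k)%N.
  rewrite lt0n; apply/eqP => k0; move: sep => /=; rewrite k0 invr0 mulr0 !mul0r expr0n/=.
  by rewrite ltNge !mulr_ge0// ?sqr_ge0// !addr0.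
have sS : (Sigma w)^T = Sigma w := sample_covariance_sym _.
have pS u : 0 <= bform (Sigma w) u u.
  rewrite bform_sample_covariance mulr_ge0 ?invr_ge0//.
  by apply: sumr_ge0 => i _; exact: sqr_ge0.
have [Ik' le_f] : #|I| = k /\ f_lambda1 (Sigma w) (support_of v) <= f_lambda1 (Sigma w) I.
  apply: (SSPCA_separated Ik kk sk sI _ hI) => i j iS jS.
  have iD := iS; rewrite inE in iS; case/andP: iS => iseed isup.
  have jseed : j \notin seed by apply: contra jS; exact: (fintype.subsetP sI).
  apply: f_avg_lt => //.
  apply: (concentrated_separation (ltW b0) spike sS d0 sI iD jS).
  - apply: c1; rewrite inE mem_cat; apply/orP; right; apply/orP; left.
    by apply/allpairsP; exists (i, j); rewrite !mem_enum.
  - apply: c1; rewrite inE mem_cat; apply/orP; right; apply/orP; right.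
    by apply/allpairsP; exists (i, j); rewrite !mem_enum.
  - by rewrite sk.
have I0 : (0 < #|I|)%N by rewrite Ik'.
have S0 : (0 < #|support_of v|)%N by rewrite Ik.
have [[u [uI u1 uE]] _] := f_lambda1_max I0 sS.
have [_ vmax] := f_lambda1_max S0 sS.
apply: (overlap_bound b0 spike sS pS d0' L0 small _ _ Ik' uI u1).
- by apply: c1; rewrite inE eqxx.
- move=> J Jk a aJ.
  apply: (sparse_net_bound (s := 2 * k) _ _ delta_ge0 _ Jk aJ).
  + by rewrite muln_gt0.
  + rewrite !trmx_mul trmxK linearB/= sS spiked_cov_sym.
    by rewrite whitening_sym mulmxA.
  + move=> z zn; rewrite bform_conj bformB.
    rewrite -(bform_spiked_cov_whitening b0 spike z).
    by apply: c2; apply/mapP; exists z.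
- have vS : supported_on (support_of v) v^T.
    by move=> j; rewrite inE negbK mxE => /eqP.
  have := vmax _ vS; rewrite (sqnorm_spike spike) mulr1 => /le_trans; apply.
  by rewrite uE.
Qed.

End Recovery.

(** * Numerical estimates and recovery at fixed parameters *)

Section Asymptotics.
Context {R : realType}.

Lemma ln_le_2ln (n p : nat) : (0 < p)%N -> (p <= n ^ 2)%N ->
  ln (p%:R : R) <= 2 * ln (n%:R : R).
Proof.
move=> p0 pn; have n0 : (0 < n)%N.
  by rewrite lt0n; apply: contraTN p0 => /eqP n0; move: pn; rewrite n0 leqn0 => /eqP ->.
rewrite mulr_natl -lnXn ?ltr0n// ler_ln ?posrE ?exprn_gt0 ?ltr0n//.
by rewrite -natrX ler_nat.
Qed.

(** Used with r = log n / n, b = beta / k and m = 2 kstar + 1. The product expands to 4 m + 2 b m +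
    2 b m^2 + b^2 m^2. The lower bound on the seed size controls the first term, the upper bound on
    k the next two, and the smallness of r the last. *)
Lemma separation_numeric (C r b m : R) :
  512 * 512 <= C -> 0 <= r -> 64 * 96 * r <= 1 -> 0 < b -> 1 <= m ->
  C * r <= b -> C * r < m * b ^+ 2 ->
  96 * r * ((2 + b) * (2 * m + b * m ^+ 2)) < (b * m) ^+ 2.
Proof.
move=> hC r0 r1 b0 m1 F1 /ltW F2.
have h1 : 512 * 512 * (r * m) <= m ^+ 2 * b ^+ 2.
  have : C * r * m <= m * b ^+ 2 * m by rewrite ler_wpM2r//; lra.
  have : 512 * 512 * (r * m) <= C * (r * m) by rewrite ler_wpM2r// mulr_ge0//; lra.
  lra.
have h2 : 512 * 512 * (r * (b * m ^+ 2)) <= m ^+ 2 * b ^+ 2.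
  have bm : 0 <= b * m ^+ 2 by rewrite (mulr_ge0 (ltW b0)) ?sqr_ge0.
  have : C * r * (b * m ^+ 2) <= b * (b * m ^+ 2) by rewrite ler_wpM2r.
  have : 512 * 512 * (r * (b * m ^+ 2)) <= C * (r * (b * m ^+ 2)).
    by rewrite ler_wpM2r// mulr_ge0.
  lra.
have h3 : r * (b * m) <= r * (b * m ^+ 2).
  by rewrite ler_wpM2l// (ler_wpM2l (ltW b0))// expr2 ler_peMl//; lra.
have h4 : 64 * 96 * r * (b ^+ 2 * m ^+ 2) <= b ^+ 2 * m ^+ 2.
  by rewrite ler_piMl// mulr_ge0 ?sqr_ge0.
have : 0 < b ^+ 2 * m ^+ 2 by rewrite mulr_gt0// exprn_gt0//; lra.
lra.
Qed.

(** Used with r = log n / n and kappa = k. Both beta and beta^2 dominate C k r, so L, its square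
    root and delta0 = sqrt(96 r) are all small multiples of beta; the bound on r also gives delta0
    <= 1/8. *)
Lemma noise_numeric (C r kappa beta L : R) :
  512 * 512 <= C -> 0 < r -> 64 * 96 * r <= 1 -> 0 < beta -> 1 <= kappa ->
  kappa * (C * r) <= beta -> kappa * (C * r) <= beta ^+ 2 ->
  0 <= L <= 224 * (kappa * r) ->
  Num.sqrt (96 * r) <= 8^-1 /\
  Num.sqrt (96 * r) * (1 + beta) + 4 * (L + Num.sqrt L) <= beta / 2.
Proof.
move=> hC r0 r1 b0 k1 rb1 rb2 /andP[L0 Lr].
have kr : 0 <= kappa * r by rewrite mulr_ge0//; lra.
(* The constant 512 * 512 exceeds 1024 * 224. *)
have CL : 1024 * L <= C * (kappa * r).
  have : 512 * 512 * (kappa * r) <= C * (kappa * r) by rewrite ler_wpM2r.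
  lra.
have rb3 : 512 * 512 * r <= beta ^+ 2.
  apply: (@le_trans _ _ (C * r)); first by rewrite ler_wpM2r// ltW.
  by apply: le_trans rb2; rewrite ler_peMl// mulr_ge0//; lra.
have Lb1 : 1024 * L <= beta by clear - CL rb1; lra.
have Lb3 : 1024 * L <= beta ^+ 2 by clear - CL rb2; lra.
have Lb2 : Num.sqrt L <= beta / 32.
  rewrite -(ler_pXn2r (n := 2))// ?nnegrE ?divr_ge0 ?(ltW b0)// sqr_sqrtr//.
  by rewrite exprMn; clear - Lb3; lra.
set delta0 := Num.sqrt (96 * r).
have d2 : delta0 ^+ 2 = 96 * r by rewrite sqr_sqrtr// mulr_ge0// ltW.
have d0 : 0 <= delta0 by exact: sqrtr_ge0.
have d8 : delta0 <= 8^-1.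
  by rewrite -(ler_pXn2r (n := 2))// ?nnegrE// d2; clear - r1; lra.
have db : delta0 <= beta / 8.
  rewrite -(ler_pXn2r (n := 2))// ?nnegrE ?divr_ge0 ?(ltW b0)// d2 exprMn.
  by clear - rb3 r0; lra.
have db' : delta0 * beta <= 8^-1 * beta by rewrite ler_wpM2r// ltW.
by split => //; clear - b0 db db' Lb1 Lb2; lra.
Qed.

(** For p >= 18 and k <= p the base is at most p^3, so the net has at most p^(6k) points. Against
    the tail p^(-7k) this leaves p^(-k) <= 1 / p. *)
Lemma net_card_bound (k p : nat) : (0 < k)%N -> (k <= p)%N -> (18 <= p)%N ->
  (((16 * k).+1 * p).+1 ^ (2 * k))%:R * (2 * expR (- (7 * k%:R * ln (p%:R : R)))) <=
  2 / p%:R.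
Proof.
move=> k0 kp p18.
have p0 : (0 : R) < p%:R by rewrite ltr0n; apply: leq_trans p18.
have h : (((16 * k).+1 * p).+1 <= p ^ 3)%N.
  apply: (@leq_trans ((16 * p).+1 * p).+1).
    by rewrite ltnS leq_mul2r ltnS leq_mul2l kp !orbT.
  nia.
have lnp : 0 <= ln (p%:R : R) by rewrite ln_ge0// ler1n; apply: leq_trans p18.
have e1 : expR (- (7 * k%:R * ln (p%:R : R))) = expR (- (k%:R * ln p%:R)) / (p%:R ^+ (6 * k)).
  rewrite -(lnK (x := p%:R)) ?posrE// -expRM_natl -expRN -expRD lnK ?posrE//.
  by congr expR; rewrite natrM; ring.
have e2 : expR (- (k%:R * ln (p%:R : R))) <= p%:R^-1.
  rewrite -[leRHS](lnK (x := p%:R^-1)) ?posrE ?invr_gt0// lnV ?posrE// ler_expR lerN2.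
  by rewrite ler_peMl// ler1n.
rewrite e1 mulrCA ler_wpM2l// mulrCA.
apply: le_trans e2; rewrite ler_piMr ?expR_ge0//.
rewrite ler_pdivrMr ?exprn_gt0// mul1r -natrX ler_nat.
have -> : (6 * k = 3 * (2 * k))%N by lia.
by rewrite (expnM p 3) leq_exp2r// muln_gt0.
Qed.

Lemma pair_card_bound (n p : nat) : (0 < n)%N -> (p <= n ^ 2)%N ->
  (2 * p ^ 2 + 1)%:R * (2 * expR (- (6 * ln (n%:R : R)))) <= 6 / n%:R.
Proof.
move=> n0 pn.
have nR : (0 : R) < n%:R by rewrite ltr0n.
have n1 : (1 : R) <= n%:R by rewrite ler1n.
have -> : expR (- (6 * ln (n%:R : R))) = (n%:R ^+ 6)^-1.
  by rewrite expRN expRM_natl lnK ?posrE.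
have h : (2 * p ^ 2 + 1 <= 3 * n ^ 4)%N.
  have : (p ^ 2 <= n ^ 4)%N by rewrite -[4%N]/(2 * 2)%N expnM leq_exp2r.
  have : (0 < n ^ 4)%N by rewrite expn_gt0 n0.
  lia.
rewrite mulrA ler_pdivrMr ?exprn_gt0//.
apply: (@le_trans _ _ (6 * n%:R ^+ 4)).
  have : ((2 * p ^ 2 + 1)%:R : R) <= (3 * n ^ 4)%:R by rewrite ler_nat.
  rewrite natrM natrX; lra.
by rewrite -mulrA ler_wpM2l// ler_pdivlMl// -exprS ler_weXn2l.
Qed.

(** The theorem at a fixed index: each asymptotic condition becomes an explicit inequality, and the
    failure probability a quantity that vanishes in the limit. *)
Lemma UBSPCA_SSPCA_recovery d (T : measurableType d) (P : probability T R)
    (n p k kstar : nat) (beta kinfo C c' : R) (v : 'cV[R]_p)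
    (x : 'I_n -> {mfun T >-> p.-tuple R}) :
  UBSPCA P k beta v x -> 512 * 512 <= C -> 0 < c' ->
  (0 < n)%N -> (18 <= p)%N -> (p <= n ^ 2)%N -> (0 < k)%N -> (kstar <= k)%N ->
  0 < ln (n%:R : R) -> 64 * 96 * ln (n%:R : R) <= n%:R ->
  0 < kinfo / (beta ^+ 2 * n%:R / ln p%:R) <= 2 * c' ->
  k%:R <= n%:R * Num.min (beta ^+ 2) beta / (C * ln n%:R) ->
  Num.floor (C * k%:R ^+ 2 * ln n%:R / (beta ^+ 2 * n%:R)) <= kstar%:Z ->
  exists A : set T, [/\ measurable A,
    (P (~` A) <= (6 / n%:R + 2 / p%:R)%:E)%E &
    A `<=` [set w | let Sigma := sample_covariance (data_matrix x w) in
       let alpha := (1 + beta) * k%:R / kinfo in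
       forall I : {set 'I_p},
         SSPCA (f_avg Sigma) (f_lambda1 Sigma) k kstar I ->
         (1 - 32 * Num.sqrt (224 * c') * Num.sqrt alpha - k%:R^-1) * k%:R
           <= #|I :&: support_of v|%:R]].
Proof.
move=> model hC c0 n0 p18 pn k0 kk ln0 nbig /andP[rho0 rho1] hk hfl.
have [beta0 spike _ _] := model.
have kp : (k <= p)%N.
  by case: spike => _ <- _; rewrite -[leqRHS]card_ord max_card.
have nR : (0 : R) < n%:R by rewrite ltr0n.
have kR : (1 : R) <= k%:R by rewrite ler1n.
have kR0 : (0 : R) < k%:R by rewrite ltr0n.
have C0 : 0 < C by lra.
set l := ln (n%:R : R) in ln0 nbig hk hfl.
have Cl0 : 0 < C * l by rewrite mulr_gt0.
rewrite ler_pdivlMr// in hk.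
have hk2 : k%:R * (C * l) <= n%:R * beta ^+ 2.
  by apply: (le_trans hk); rewrite ler_wpM2l ?(ltW nR)// ge_min lexx.
have hk1 : k%:R * (C * l) <= n%:R * beta.
  by apply: (le_trans hk); rewrite ler_wpM2l ?(ltW nR)// ge_min lexx orbT.
have b0 : 0 < beta.
  rewrite lt0r beta0 andbT; apply: contraTneq hk1 => ->.
  by rewrite mulr0 -ltNge mulr_gt0.
have b2 : 0 < beta ^+ 2 by rewrite exprn_gt0.
pose r := l / n%:R.
have lE : l = r * n%:R by rewrite /r mulfVK// gt_eqF.
have r0 : 0 < r by rewrite divr_gt0.
have r1 : 64 * 96 * r <= 1 by rewrite /r mulrA ler_pdivrMr// mul1r.
have rb2 : k%:R * (C * r) <= beta ^+ 2.
  by rewrite -(ler_pM2l nR); move: hk2; rewrite lE; clear; lra.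
have rb1 : k%:R * (C * r) <= beta.
  by rewrite -(ler_pM2l nR); move: hk1; rewrite lE; clear; lra.
have Cr0 : 0 <= C * r by rewrite mulr_ge0 ?(ltW C0) ?(ltW r0).
have rbb2 : C * r <= beta ^+ 2 by apply: le_trans rb2; rewrite ler_peMl.
pose lp := ln (p%:R : R).
have p0 : (0 < p)%N by apply: leq_trans p18.
have lp0 : 0 < lp by rewrite ln_gt0// ltr1n; apply: leq_trans p18.
have lp2 : lp <= 2 * l by exact: ln_le_2ln.
(* In the exponent 16 of the tail bound, 112 = 16 * 7 beats the p ^ (6 * k)
   points of the net and 96 = 16 * 6 beats the 2 p ^ 2 + 1 = O(n ^ 4) vectors
   used for the greedy step. *)
pose L := 112 * k%:R * lp / n%:R.
have L0 : 0 <= L by rewrite divr_ge0 ?(ltW nR)// mulr_ge0 ?(ltW lp0)// mulr_ge0.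
have Lr : L <= 224 * (k%:R * r).
  have E : 224 * (k%:R * r) * n%:R = 224 * (k%:R * l).
    by rewrite [in RHS]lE; clear; ring.
  rewrite /L ler_pdivrMr// E.
  have : k%:R * lp <= k%:R * (2 * l) by rewrite ler_wpM2l.
  by clear; lra.
have Lr' : 0 <= L <= 224 * (k%:R * r) by rewrite L0.
have [d8 small] := noise_numeric hC r0 r1 b0 kR rb1 rb2 Lr'.
pose delta0 := Num.sqrt (96 * r); rewrite -/delta0 in d8 small.
have d0 : 0 <= delta0 by exact: sqrtr_ge0.
have d2 : delta0 ^+ 2 = 96 * r by rewrite sqr_sqrtr// mulr_ge0// ltW.
have d01 : 0 <= delta0 <= 1 by rewrite d0; clear - d8; lra.
have sep : let m : R := (2 * kstar + 1)%:R in let b : R := beta / k%:R in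
    delta0 ^+ 2 * ((2 + b) * (2 * m + b * m ^+ 2)) < (b * m) ^+ 2.
  move=> m b; rewrite d2.
  have bE : beta = b * k%:R by rewrite /b mulfVK// gt_eqF.
  apply: (separation_numeric hC (ltW r0) r1) => //.
  - by rewrite /b divr_gt0.
  - by rewrite ler1n addn1.
  - by rewrite /b ler_pdivlMr// mulrC.
  (* A real number is strictly below its floor plus one, hence below kstar + 1 <= 2 kstar + 1 = m.
     The floor is thus harmless, even for an empty seed. *)
  - have : C * k%:R ^+ 2 * l / (beta ^+ 2 * n%:R) < m.
      apply: (@lt_le_trans _ _ (kstar%:R + 1)).
        have := Num.Theory.floorD1_gt (C * k%:R ^+ 2 * l / (beta ^+ 2 * n%:R)).
        move=> /lt_le_trans; apply.
        have -> : (kstar%:R + 1 : R) = (kstar%:Z + 1)%:~R by rewrite intrD.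
        by rewrite ler_int lerD2r.
      by rewrite natr1 ler_nat addn1 ltnS leq_pmull.
    rewrite ltr_pdivrMr ?mulr_gt0// lE {1}bE => h.
    have k2 : (0 : R) < k%:R ^+ 2 * n%:R by rewrite mulr_gt0// exprn_gt0.
    by rewrite -(ltr_pM2r k2); clear - h; lra.
have [A [mA PA Asub]] := SSPCA_recovery model n0 b0 kk d01 L0 small sep.
exists A; split => //.
  apply: (le_trans PA); rewrite lee_fin lerD//.
    rewrite d2 (_ : n%:R * _ / 16 = 6 * l); first exact: pair_card_bound.
    by rewrite lE; clear; field.
  rewrite (_ : n%:R * L / 16 = 7 * k%:R * lp); first exact: net_card_bound.
  by rewrite /L; clear - nR; field; rewrite gt_eqF.
move=> w /Asub h /= I /h.
apply: le_trans; rewrite ler_wpM2r//.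
set alpha := (1 + beta) * k%:R / kinfo.
(* The squared left side is 112 alpha times kinfo / q, and this ratio is at most 2 c', whence 224
   c'. *)
suff : Num.sqrt ((1 + beta) * L) / beta <= Num.sqrt (224 * c') * Num.sqrt alpha.
  have : 0 <= k%:R^-1 :> R by rewrite invr_ge0.
  by clear; lra.
set q := beta ^+ 2 * n%:R / ln p%:R in rho0 rho1 *.
have q0 : 0 < q by rewrite divr_gt0// mulr_gt0.
have kinfo0 : 0 < kinfo by move: rho0; rewrite pmulr_lgt0// invr_gt0.
have b1 : 0 <= 1 + beta by rewrite addr_ge0.
have alpha0 : 0 <= alpha by rewrite divr_ge0 ?(ltW kinfo0)// mulr_ge0.
have bE : beta = Num.sqrt (beta ^+ 2) by rewrite sqrtr_sqr ger0_norm.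
have c'0 : 0 <= 224 * c' by apply: mulr_ge0; [exact: ler0n|exact: ltW].
have bL0 : 0 <= (1 + beta) * L by rewrite mulr_ge0.
rewrite [X in _ / X <= _]bE -(sqrtrV (ltW b2)) -!sqrtrM//.
rewrite ler_sqrt; last by rewrite mulr_ge0.
have -> : (1 + beta) * L / beta ^+ 2 = 112 * (alpha * (kinfo / q)).
  rewrite /L /alpha /q -/lp; clear - kinfo0 b0 nR lp0; field.
  by rewrite !gt_eqF.
have : alpha * (kinfo / q) <= alpha * (2 * c') by rewrite ler_wpM2l.
by clear; lra.
Qed.

End Asymptotics.

(** * Passage to the limit *)

Lemma ln_linear_near (R : realType) (M : R) :
  \forall m \near \oo, [/\ (0 < m)%N, 0 < ln (m%:R : R) & M * ln m%:R <= m%:R].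
Proof.
have [M0|M0] := leP M 0.
  near=> m; have m1 : (1 < m)%N by near: m; exact: nbhs_infty_gt.
  have l0 : 0 < ln (m%:R : R) by rewrite ln_gt0// ltr1n.
  split => //; first exact: ltnW.
  by apply: (@le_trans _ _ 0) => //; rewrite mulr_le0_ge0// ltW.
near=> m.
have m1 : (1 < m)%N by near: m; exact: nbhs_infty_gt.
have mM : (2 * M) ^+ 2 <= m%:R by near: m; exact: nbhs_infty_ger.
have l0 : 0 < ln (m%:R : R) by rewrite ln_gt0// ltr1n.
have m0 : (0 : R) < m%:R by rewrite ltr0n ltnW.
split => //; first exact: ltnW.
have s2 : Num.sqrt (m%:R : R) ^+ 2 = m%:R by rewrite sqr_sqrtr// ltW.
have s0 : 0 < Num.sqrt (m%:R : R) by rewrite sqrtr_gt0.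
(* The sublinearity of [ln] is applied at the square root of m, and 2 M is eventually below that
   root. *)
have ls : ln (m%:R : R) <= 2 * Num.sqrt m%:R.
  rewrite -{1}s2 lnXn// -[leLHS]mulr_natl ler_wpM2l//.
  by have := ln_sublinear s0 => /ltW.
have sM : 2 * M <= Num.sqrt (m%:R : R).
  by rewrite -(ler_pXn2r (n := 2))// ?nnegrE ?s2// ?mulr_ge0// ltW.
have : M * ln m%:R <= M * (2 * Num.sqrt m%:R) by rewrite ler_wpM2l// ltW.
have : 2 * M * Num.sqrt m%:R <= Num.sqrt (m%:R : R) ^+ 2.
  by rewrite expr2 ler_wpM2r// ltW.
rewrite s2; clear; lra.
Unshelve. all: by end_near. Qed.

Lemma cvg_natrV0 (R : realType) (u : nat -> nat) : u @ \oo --> \oo ->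
  (fun t => (u t)%:R^-1 : R) @ \oo --> (0 : R).
Proof.
move=> hu; apply/gtr0_cvgV0; last exact/cvgrnyP.
near=> t; rewrite ltr0n; near: t.
by apply: (hu [set m | (0 < m)%N]); exact: nbhs_infty_gt.
Unshelve. all: by end_near. Qed.

Theorem theorem4p5 (R : realType) :
  exists2 C0 : R, 0 < C0 &
  forall c' : R, 0 < c' ->
  exists2 K : R, 0 < K &
  forall (C : R) (d : nat -> measure_display)
    (T : forall t, measurableType (d t)) (P : forall t, probability (T t) R)
    (n p k kstar : nat -> nat) (beta kinfo : nat -> R) (c : R)
    (v : forall t, 'cV[R]_(p t))
    (x : forall t, 'I_(n t) -> {mfun T t >-> (p t).-tuple R}),
  C0 <= C ->
  (forall t, UBSPCA (P t) (k t) (beta t) (v t) (@x t)) ->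
  n @ \oo --> \oo -> p @ \oo --> \oo -> k @ \oo --> \oo ->
  0 <= c ->
  (fun t => (p t)%:R / (n t)%:R : R) @ \oo --> c ->
  (fun t => kinfo t / (beta t ^+ 2 * (n t)%:R / ln (p t)%:R)) @ \oo --> c' ->
  (\forall t \near \oo,
     (k t)%:R <= (n t)%:R * Num.min (beta t ^+ 2) (beta t)
                 / (C * ln (n t)%:R)) ->
  (\forall t \near \oo, (kstar t <= k t)%N) ->
  (\forall t \near \oo,
     Num.floor (C * (k t)%:R ^+ 2 * ln (n t)%:R / (beta t ^+ 2 * (n t)%:R))
       <= (kstar t)%:Z) ->
  with_probability_tending_to_1 P (fun t =>
    [set w | let Sigma := sample_covariance (data_matrix (@x t) w) in
       let alpha := (1 + beta t) * (k t)%:R / kinfo t in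
       forall I : {set 'I_(p t)},
         SSPCA (f_avg Sigma) (f_lambda1 Sigma) (k t) (kstar t) I ->
         (1 - K * Num.sqrt alpha - (k t)%:R^-1) * (k t)%:R
           <= #|I :&: support_of (v t)|%:R]).
Proof.
exists (512 * 512); first by apply: mulr_gt0; rewrite ltr0n.
(* The threshold on C is universal, whereas the constant of the O depends on c' only, which sets the
   scale of kinfo. *)
move=> c' c'0; exists (32 * Num.sqrt (224 * c')).
  by apply: mulr_gt0; rewrite ?sqrtr_gt0 ?pmulr_rgt0 ?ltr0n.
move=> C d T P n p k kstar beta kinfo c v x hC model hn hp hk c0 hpn hrho hkn hkk hfl.
set E := fun t => [set w | _].
have n_large (N : nat) : \forall t \near \oo, (N <= n t)%N.
  by apply: (hn [set m | (N <= m)%N]); exact: nbhs_infty_ge.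
have p_large (N : nat) : \forall t \near \oo, (N <= p t)%N.
  by apply: (hp [set m | (N <= m)%N]); exact: nbhs_infty_ge.
have k_large : \forall t \near \oo, (0 < k t)%N.
  by apply: (hk [set m | (0 < m)%N]); exact: nbhs_infty_gt.
have ln_n : \forall t \near \oo,
    [/\ (0 < n t)%N, 0 < ln ((n t)%:R : R) & 64 * 96 * ln ((n t)%:R : R) <= (n t)%:R].
  exact: (hn _ (ln_linear_near (64 * 96))).
(* Eventually p / n <= c + 1 <= n. This is how the limit of p / n lets log p be replaced by a
   multiple of log n. *)
have pn2 : \forall t \near \oo, (p t <= n t ^ 2)%N.
  near=> t.
  have [n0 _ _] :
      [/\ (0 < n t)%N, 0 < ln ((n t)%:R : R) & 64 * 96 * ln ((n t)%:R : R) <= (n t)%:R].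
    by near: t.
  have nR : (0 : R) < (n t)%:R by rewrite ltr0n.
  have h1 : (p t)%:R / (n t)%:R <= c + 1.
    by near: t; apply: (cvgr_le _ hpn); rewrite ltrDl.
  have h2 : c + 1 <= (n t)%:R.
    by near: t; exact: (hn _ (nbhs_infty_ger (c + 1))).
  rewrite -(ler_nat R) natrX expr2 -ler_pdivrMr//.
  exact: le_trans h1 h2.
have rho_near : \forall t \near \oo,
    0 < kinfo t / (beta t ^+ 2 * (n t)%:R / ln (p t)%:R) <= 2 * c'.
  near=> t; apply/andP; split; near: t.
  - exact: (cvgr_gt _ hrho).
  - by apply: (cvgr_le _ hrho); rewrite ltr_pMl// ltr1n.
pose err t : R := 6 / (n t)%:R + 2 / (p t)%:R.
(* An event is required at every index, whereas the estimate only holds eventually. The empty set is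
   the default, and the probability bound is conditional on some suitable event existing. *)
have hA t : exists A : set (T t), [/\ measurable A, A `<=` E t &
    (exists2 B : set (T t), measurable B /\ (P t (~` B) <= (err t)%:E)%E & B `<=` E t) ->
    (P t (~` A) <= (err t)%:E)%E].
  have [[B [mB PB] BE]|nB] := pselect (exists2 B : set (T t),
      measurable B /\ (P t (~` B) <= (err t)%:E)%E & B `<=` E t).
    by exists B.
  by exists set0; split => //.
pose A t := projT1 (cid (hA t)).
have mA t : measurable (A t) by rewrite /A; case: cid => ? [].
exists A; split.
  by move=> t; split; rewrite /A; case: cid => ? [].
have PA : \forall t \near \oo, (P t (~` A t) <= (err t)%:E)%E.
  near=> t.
  have [n0 l0 l1] :
      [/\ (0 < n t)%N, 0 < ln ((n t)%:R : R) & 64 * 96 * ln ((n t)%:R : R) <= (n t)%:R].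
    by near: t.
  rewrite /A; case: cid => B [mB BE /= hB]; apply: hB.
  have [D [mD PD DE]] : exists D : set (T t), [/\ measurable D,
      (P t (~` D) <= (err t)%:E)%E & D `<=` E t].
    apply: (UBSPCA_SSPCA_recovery (model t) hC c'0 n0 _ _ _ _ l0 l1).
    - by near: t; exact: p_large.
    - by near: t.
    - by near: t.
    - by near: t.
    - by near: t.
    - by near: t.
    - by near: t.
  by exists D.
have PA' : \forall t \near \oo, ((1 - err t)%:E <= P t (A t) <= 1)%E.
  near=> t; apply/andP; split; last exact: probability_le1.
  have : (P t (~` A t) <= (err t)%:E)%E by near: t.
  have fA : P t (A t) \is a fin_num by exact: fin_num_measure.
  by rewrite probability_setC// EFinB !leeBlDr// addeC.
apply: (squeeze_cvge PA'); last exact: cvg_cst.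
apply: cvg_EFin; first by near=> t.
rewrite -[X in _ --> X](subr0 1); apply: cvgB; first exact: cvg_cst.
rewrite -(addr0 0) -[X in _ --> X + _](mulr0 6) -[X in _ --> _ + X](mulr0 2).
by apply: cvgD; apply: cvgMr; exact: cvg_natrV0.
Unshelve. all: by end_near. Qed.
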